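(* Let $H:\mathbb{R}^2\times\mathbb{R}\times\mathbb{R}^2\times\mathcal{S}^{2\times2}\to\mathbb{R}$ be a function. The second order differential operator $H(\cdot,u,\nabla u,\nabla^2u)$ is conformally invariant in $\mathbb{R}^2$ if and only if there exists a function $g:\mathbb{R}\to\mathbb{R}$ such that $$H(\cdot,u,\nabla u,\nabla^2u)=g(-e^{-u}\Delta u)$$ (i.e. this identity holds for every $u\in C^2(\mathbb{R}^2)$ at every point of $\mathbb{R}^2$).
   Context: $\mathcal{S}^{2\times2}$ denotes the set of $2\times2$ real symmetric matrices, and $\mathbb{C}$ is identified with $\mathbb{R}^2$ via $z=x_1+\sqrt{-1}x_2$. For a $C^2$ function $u$ and a holomorphic map $\psi$ with nonzero Jacobian determinant, viewed as a map between subsets of $\mathbb{R}^2$, put $u_\psi:=u\circ\psi+\ln|J_\psi|$, where $|J_\psi|$ is the Jacobian determinant of $\psi$ (so $|J_\psi|=|\psi'|^2$). The operator $H(\cdot,u,\nabla u,\nabla^2u)$ is called conformally invariant if for every meromorphic function $\psi$ on $\mathbb{C}$ and every $u\in C^2(\mathbb{R}^2)$, $$H(\cdot,u_\psi,\nabla u_\psi,\nabla^2u_\psi)=H(\cdot,u,\nabla u,\nabla^2u)\circ\psi$$ at every point $z\in\mathbb{C}$ that is neither a pole of $\psi$ nor a zero of $\psi'$. Here $H(\cdot,u,\nabla u,\nabla^2u)$ denotes the function $x\mapsto H(x,u(x),\nabla u(x),\nabla^2u(x))$. No regularity is assumed on $H$ or $g$. *)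

(* Defs.v *)
From Stdlib Require Import Reals Lia.
From Coquelicot Require Import Coquelicot.
Open Scope R_scope.

(* Points of the plane are pairs of reals; Coquelicot's [C] is by definition
   [R * R], which is the identification of the complex plane with R^2. *)

Definition is_symmetric (A : @matrix R 2 2) : Prop :=
  forall i j : nat, (i < 2)%nat -> (j < 2)%nat ->
    coeff_mat 0 A i j = coeff_mat 0 A j i.

Definition Sym2 : Type := {A : @matrix R 2 2 | is_symmetric A}.

Definition sym_entries (a b c : R) : @matrix R 2 2 :=
  [ [ a, b ], [ b, c ] ].

Lemma sym_entries_symmetric (a b c : R) : is_symmetric (sym_entries a b c).
Proof.
  intros i j Hi Hj.
  destruct i as [|[|i]]; [| | lia]; (destruct j as [|[|j]]; [| | lia]);
    reflexivity.
Qed.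

Definition mk_sym (a b c : R) : Sym2 :=
  exist _ (sym_entries a b c) (sym_entries_symmetric a b c).

Definition D1 (u : R * R -> R) (p : R * R) : R :=
  Derive (fun t => u (t, snd p)) (fst p).

Definition D2 (u : R * R -> R) (p : R * R) : R :=
  Derive (fun t => u (fst p, t)) (snd p).

Definition is_C1 (u : R * R -> R) : Prop :=
  forall p : R * R,
    ex_derive (fun t => u (t, snd p)) (fst p) /\
    ex_derive (fun t => u (fst p, t)) (snd p) /\
    continuous u p /\ continuous (D1 u) p /\ continuous (D2 u) p.

Definition is_C2 (u : R * R -> R) : Prop :=
  is_C1 u /\ is_C1 (D1 u) /\ is_C1 (D2 u).

Definition grad (u : R * R -> R) (p : R * R) : R * R := (D1 u p, D2 u p).

(* [D1 (D2 u)] serves as both off-diagonal entries, so that the Hessian is a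
   symmetric matrix by construction; where u is C^2 the two mixed partial
   derivatives agree by Schwarz's theorem. *)
Definition hessian (u : R * R -> R) (p : R * R) : Sym2 :=
  mk_sym (D1 (D1 u) p) (D1 (D2 u) p) (D2 (D2 u) p).

Definition laplacian (u : R * R -> R) (p : R * R) : R :=
  D1 (D1 u) p + D2 (D2 u) p.

Definition operator (H : R * R -> R -> R * R -> Sym2 -> R)
    (u : R * R -> R) (x : R * R) : R :=
  H x (u x) (grad u x) (hessian u x).

Definition complex_differentiable (psi : C -> C) (z : C) : Prop :=
  @ex_derive C_AbsRing C_NormedModule psi z.

Definition holomorphic_at (psi : C -> C) (z : C) : Prop :=
  locally z (complex_differentiable psi).

Definition is_pole (psi : C -> C) (z : C) : Prop :=
  locally' z (complex_differentiable psi) /\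
  filterlim (fun w => Cmod (psi w)) (locally' z) (Rbar_locally p_infty).

(* A meromorphic function is represented by a total function, whose value at
   a pole is arbitrary.  The poles are isolated since [is_pole] requires
   differentiability on a punctured neighbourhood. *)
Definition meromorphic (psi : C -> C) : Prop :=
  forall z : C, holomorphic_at psi z \/ is_pole psi z.

Definition zero_of_derivative (psi : C -> C) (z : C) : Prop :=
  @is_derive C_AbsRing C_NormedModule psi z (RtoC 0).

Definition jacobian (psi : R * R -> R * R) (p : R * R) : R :=
  D1 (fun q => fst (psi q)) p * D2 (fun q => snd (psi q)) p -
  D2 (fun q => fst (psi q)) p * D1 (fun q => snd (psi q)) p.

Definition conformal_change (u : R * R -> R) (psi : R * R -> R * R)
    (p : R * R) : R :=
  u (psi p) + ln (Rabs (jacobian psi p)).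

Definition conformally_invariant
    (H : R * R -> R -> R * R -> Sym2 -> R) : Prop :=
  forall (psi : C -> C) (u : R * R -> R),
    meromorphic psi -> is_C2 u ->
    forall z : C,
      ~ is_pole psi z -> ~ zero_of_derivative psi z ->
      operator H (conformal_change u psi) z = operator H u (psi z).

(* Main.v *)
Require Import Defs.
From Stdlib Require Import Reals Lra Lia ClassicalEpsilon FunctionalExtensionality.
From Coquelicot Require Import Coquelicot.
Open Scope R_scope.

(* Necessity: given u and x, there is a cubic polynomial psi with psi(0) = x for which the
   2-jet of u_psi at 0 has value 0, gradient 0 and a scalar Hessian (psi'(0) = e^{-u(x)/2}
   normalizes the value, psi''(0) the gradient, psi'''(0) the trace-free part of the
   Hessian); its trace is then e^{-u(x)} (Laplacian u)(x), so H at the jet of u is a function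
   of this number alone.
   Sufficiency: H only sees the 2-jet of u_psi, which is also the 2-jet of a quadratic
   polynomial, so all that is needed is Laplacian(u_psi) = |psi'|^2 (Laplacian u) o psi.
   That requires psi to have three complex derivatives although holomorphy only asserts
   pointwise differentiability near z.  By Goursat's theorem psi has a local primitive F;
   since F' = psi is differentiable, F has a second-order expansion at every w, so
   (F(zeta) - F(w)) / (zeta - w) is holomorphic at w too and has itself a primitive.  Its
   integral over a circle therefore vanishes, which is Cauchy's formula for F. *)

(** * Complex differentiability *)

(** The cubic has exactly the freedom required: psi(0) moves the base point, |psi'(0)| shifts the
    value, and psi''(0) and psi'''(0) give two real parameters each, for the gradient and for the
    trace-free Hessian. The argument of psi'(0), which only rotates, is fixed by taking psi'(0) > 0.
    The trace is out of reach because ln|psi'|^2 is harmonic; it only scales by |psi'|^2, hence the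
    factor e^{-u}. Zeros of psi' away from 0 do no harm, invariance being a pointwise condition. In
    the converse direction the obstacle is that u_psi is singular at zeros of psi' and arbitrary at
    poles, while the identity with g is given only for functions that are C^2 on the whole plane;
    this is why the jet is handed over to a polynomial. *)

Definition is_Cderive (f : C -> C) (z l : C) : Prop :=
  @is_derive C_AbsRing C_NormedModule f z l.

Lemma is_Cderive_eps (f : C -> C) (z l : C) :
  is_Cderive f z l <->
  forall eps : posreal, exists delta : posreal, forall w : C,
    Cmod (w - z) < delta ->
    Cmod (f w - f z - (w - z) * l) <= eps * Cmod (w - z).
Proof.
  split.
  - intros [_ Hd] eps.
    destruct (Hd z (fun P HP => HP) eps) as [delta Hdelta].
    exists delta. intros w Hw. exact (Hdelta w Hw).
  - intros Hf. split.
    + apply is_linear_scal_l.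
    + intros x Hx.
      apply (@is_filter_lim_locally_unique C_AbsRing (AbsRing_NormedModule C_AbsRing)) in Hx.
      subst x.
      intros eps. destruct (Hf eps) as [delta Hdelta].
      exists delta. intros w Hw. exact (Hdelta w Hw).
Qed.

(** [C_NormedModule] and [AbsRing_NormedModule C_AbsRing] are two packagings of C as a module over
    itself; the rules for products and for the identity are applied in the second. *)
Lemma is_Cderive_AbsRing (f : C -> C) (z l : C) :
  is_Cderive f z l <-> @is_derive C_AbsRing (AbsRing_NormedModule C_AbsRing) f z l.
Proof.
  split; intros [Hl Hd]; split.
  - apply @is_linear_scal_l.
  - exact Hd.
  - apply @is_linear_scal_l.
  - exact Hd.
Qed.

Lemma norm_C_R (z : C) : @norm R_AbsRing C_R_NormedModule z = Cmod z.
Proof.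
  change (sqrt (Rabs (fst z) ^ 2 + Rabs (snd z) ^ 2) = sqrt (fst z ^ 2 + snd z ^ 2)).
  now rewrite !pow2_abs.
Qed.

Lemma C_eq (x y : C) : fst x = fst y -> snd x = snd y -> x = y.
Proof. destruct x, y; simpl; intros; subst; auto. Qed.

Lemma fst_le_Cmod (z : C) : Rabs (fst z) <= Cmod z.
Proof. eapply Rle_trans; [apply Rmax_l | apply Rmax_Cmod]. Qed.
Lemma snd_le_Cmod (z : C) : Rabs (snd z) <= Cmod z.
Proof. eapply Rle_trans; [apply Rmax_r | apply Rmax_Cmod]. Qed.
Lemma Cmod_le_sum (z : C) : Cmod z <= Rabs (fst z) + Rabs (snd z).
Proof.
  apply Rsqr_incr_0_var.
  - unfold Cmod. rewrite Rsqr_sqrt by nra. unfold Rsqr.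
    assert (H1 := Rabs_pos (fst z)). assert (H2 := Rabs_pos (snd z)).
    assert (H3 := Rsqr_abs (fst z)). assert (H4 := Rsqr_abs (snd z)).
    unfold Rsqr in *. nra.
  - assert (H1 := Rabs_pos (fst z)). assert (H2 := Rabs_pos (snd z)). lra.
Qed.

Lemma Cmult_is_linear (l : C) :
  @is_linear R_AbsRing C_R_NormedModule C_R_NormedModule (fun y => Cmult y l).
Proof.
  split.
  - intros x y. apply Cmult_plus_distr_r.
  - intros k x. apply C_eq; simpl; unfold scal, mult; simpl; unfold mult; simpl; ring.
  - exists (Cmod l + 1). split.
    + assert (H := Cmod_ge_0 l). lra.
    + intros x. rewrite !norm_C_R, Cmod_mult.
      assert (H := Cmod_ge_0 l). assert (H' := Cmod_ge_0 x). nra.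
Qed.

Lemma locally_Cmod (z : C) (P : C -> Prop) :
  @locally C_UniformSpace z P <->
  exists delta : posreal, forall w, Cmod (w - z) < delta -> P w.
Proof. split; intros H; apply locally_C in H || apply locally_C; exact H. Qed.

(** Over the reals the differential is multiplication by l; in this form it composes with real
    curves. *)
Lemma is_Cderive_filterdiff (f : C -> C) (z l : C) :
  is_Cderive f z l ->
  @filterdiff R_AbsRing C_R_NormedModule C_R_NormedModule f
    (locally z) (fun y => Cmult y l).
Proof.
  intros Hf. split.
  - apply Cmult_is_linear.
  - intros x Hx.
    apply (@is_filter_lim_locally_unique R_AbsRing C_R_NormedModule) in Hx. subst x.
    intros eps. apply (proj2 (locally_Cmod z _)).
    destruct (proj1 (is_Cderive_eps f z l) Hf eps) as [delta Hdelta].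
    exists delta. intros w Hw. rewrite !norm_C_R. exact (Hdelta w Hw).
Qed.

Lemma is_Cderive_continuous (f : C -> C) (z l : C) :
  is_Cderive f z l -> @continuous C_UniformSpace C_UniformSpace f z.
Proof.
  intros Hf.
  apply (@filterdiff_continuous R_AbsRing C_R_NormedModule C_R_NormedModule).
  eexists. apply is_Cderive_filterdiff, Hf.
Qed.

(** A single chain rule serves complex differentiable maps, the coordinate projections and C^1 real
    functions. *)
Lemma is_derive_comp_filterdiff (V : NormedModule R_AbsRing)
    (f : C -> V) (L : C -> V) (gamma : R -> C) (t : R) (dg : C) :
  @filterdiff R_AbsRing C_R_NormedModule V f (locally (gamma t)) L ->
  @is_derive R_AbsRing C_R_NormedModule gamma t dg ->
  @is_derive R_AbsRing V (fun s => f (gamma s)) t (L dg).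
Proof.
  intros Hf Hg.
  unfold is_derive in *.
  apply filterdiff_ext_lin with (fun y : R => L (scal y dg)).
  - apply (@filterdiff_comp' R_AbsRing R_NormedModule C_R_NormedModule V gamma f t _ L Hg Hf).
  - intros y. destruct Hf as [HL _].
    apply (@linear_scal R_AbsRing C_R_NormedModule V L HL).
Qed.

Lemma is_derive_Cderive_comp (f : C -> C) (gamma : R -> C) (t : R) (l dg : C) :
  is_Cderive f (gamma t) l ->
  @is_derive R_AbsRing C_R_NormedModule gamma t dg ->
  @is_derive R_AbsRing C_R_NormedModule (fun s => f (gamma s)) t (dg * l)%C.
Proof.
  intros Hf Hg.
  exact (is_derive_comp_filterdiff _ f (fun y => Cmult y l) gamma t dg
    (is_Cderive_filterdiff _ _ _ Hf) Hg).
Qed.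

Lemma is_derive_fst (g : R -> C) (t : R) (l : C) :
  @is_derive R_AbsRing C_R_NormedModule g t l ->
  is_derive (fun s => fst (g s)) t (fst l).
Proof.
  intros Hg.
  apply (is_derive_comp_filterdiff R_NormedModule fst fst g t l); trivial.
  apply (@filterdiff_linear R_AbsRing C_R_NormedModule R_NormedModule).
  apply is_linear_fst.
Qed.

Lemma is_derive_snd (g : R -> C) (t : R) (l : C) :
  @is_derive R_AbsRing C_R_NormedModule g t l ->
  is_derive (fun s => snd (g s)) t (snd l).
Proof.
  intros Hg.
  apply (is_derive_comp_filterdiff R_NormedModule snd snd g t l); trivial.
  apply (@filterdiff_linear R_AbsRing C_R_NormedModule R_NormedModule).
  apply is_linear_snd.
Qed.

Lemma is_derive_pair (g1 g2 : R -> R) (t l1 l2 : R) :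
  is_derive g1 t l1 -> is_derive g2 t l2 ->
  @is_derive R_AbsRing C_R_NormedModule (fun s => (g1 s, g2 s)) t (l1, l2).
Proof.
  intros H1 H2.
  apply filterdiff_ext_lin with (fun y : R => (scal y l1, scal y l2)); [|reflexivity].
  apply (@filterdiff_comp'_2 R_AbsRing R_NormedModule R_NormedModule R_NormedModule
    C_R_NormedModule
    g1 g2 (fun x y => (x,y)) t (fun y : R => scal y l1) (fun y : R => scal y l2)
      (fun x y => (x,y)) H1 H2).
  apply filterdiff_ext_lin with (fun t : R*R => t); [|intros [a b]; reflexivity].
  apply filterdiff_ext with (fun t : R*R => t); [intros [a b]; reflexivity|].
  apply (@filterdiff_id R_AbsRing C_R_NormedModule).
Qed.

Lemma is_Cderive_unique (f : C -> C) (z l1 l2 : C) :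
  is_Cderive f z l1 -> is_Cderive f z l2 -> l1 = l2.
Proof.
  intros H1 H2.
  rewrite <- (is_C_derive_unique f z l1 H1). apply is_C_derive_unique, H2.
Qed.

(** * Goursat's theorem and local primitives *)

Definition Ccont (f : C -> C) (z : C) : Prop :=
  @continuous C_UniformSpace C_UniformSpace f z.

(** * Integrals of complex-valued functions of a real variable *)

Definition is_CInt (f : R -> C) (a b : R) (l : C) : Prop :=
  @is_RInt C_R_NormedModule f a b l.

Definition CInt (f : R -> C) (a b : R) : C :=
  @RInt C_R_CompleteNormedModule f a b.

Definition continuous_between (f : R -> C) (a b : R) : Prop :=
  forall t : R, Rmin a b <= t <= Rmax a b ->
    @continuous R_UniformSpace C_UniformSpace f t.

Lemma CInt_unique (f : R -> C) (a b : R) (l : C) :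
  is_CInt f a b l -> CInt f a b = l.
Proof. intros H. apply (@is_RInt_unique C_R_CompleteNormedModule), H. Qed.

Lemma CInt_correct (f : R -> C) (a b : R) :
  continuous_between f a b -> is_CInt f a b (CInt f a b).
Proof.
  intros H. apply (@RInt_correct C_R_CompleteNormedModule).
  apply (@ex_RInt_continuous C_R_CompleteNormedModule), H.
Qed.

(** The integral in a real module is linear over R only, so a complex factor is moved through the
    components. *)
Lemma is_CInt_mult (k : C) (f : R -> C) (a b : R) (l : C) :
  is_CInt f a b l -> is_CInt (fun t => (k * f t)%C) a b (k * l)%C.
Proof.
  intros H.
  assert (H1 := is_RInt_fct_extend_fst f a b l H).
  assert (H2 := is_RInt_fct_extend_snd f a b l H).
  apply (is_RInt_fct_extend_pair (U:=R_NormedModule) (V:=R_NormedModule)).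
  - apply (is_RInt_minus (V:=R_NormedModule) (fun t => scal (fst k) (fst (f t)))
      (fun t => scal (snd k) (snd (f t))));
      apply (is_RInt_scal (V:=R_NormedModule)); assumption.
  - apply (is_RInt_plus (V:=R_NormedModule) (fun t => scal (fst k) (snd (f t)))
      (fun t => scal (snd k) (fst (f t))));
      apply (is_RInt_scal (V:=R_NormedModule)); assumption.
Qed.

Lemma CInt_mult (k : C) (f : R -> C) (a b : R) :
  continuous_between f a b -> CInt (fun t => (k * f t)%C) a b = (k * CInt f a b)%C.
Proof. intros H. apply CInt_unique, is_CInt_mult, CInt_correct, H. Qed.

Lemma CInt_minus (f g : R -> C) (a b : R) :
  continuous_between f a b -> continuous_between g a b ->
  CInt (fun t => (f t - g t)%C) a b = (CInt f a b - CInt g a b)%C.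
Proof.
  intros Hf Hg. apply CInt_unique.
  apply (is_RInt_minus (V:=C_R_NormedModule)); apply CInt_correct; assumption.
Qed.

Lemma CInt_Chasles (f : R -> C) (a b c : R) :
  continuous_between f a b -> continuous_between f b c ->
  CInt f a c = (CInt f a b + CInt f b c)%C.
Proof.
  intros Hf Hg. apply CInt_unique.
  apply (is_RInt_Chasles (V:=C_R_NormedModule)) with b; apply CInt_correct; assumption.
Qed.

Lemma CInt_swap (f : R -> C) (a b : R) :
  continuous_between f a b -> CInt f b a = (- CInt f a b)%C.
Proof.
  intros Hf. apply CInt_unique.
  apply (is_RInt_swap (V:=C_R_NormedModule)), CInt_correct; assumption.
Qed.

Lemma CInt_const (k : C) (a b : R) : CInt (fun _ => k) a b = (RtoC (b - a) * k)%C.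
Proof.
  apply CInt_unique.
  replace (RtoC (b - a) * k)%C with (@scal _ C_R_NormedModule (b - a) k).
  - apply (is_RInt_const (V:=C_R_NormedModule)).
  - apply C_eq; simpl; unfold scal; simpl; unfold mult; simpl; ring.
Qed.

Lemma CInt_ext (f g : R -> C) (a b : R) :
  (forall t, Rmin a b <= t <= Rmax a b -> f t = g t) -> CInt f a b = CInt g a b.
Proof.
  intros H. apply (@RInt_ext C_R_CompleteNormedModule).
  intros x Hx. apply H. lra.
Qed.

Lemma Cmod_CInt_le (f : R -> C) (a b M : R) :
  a <= b -> continuous_between f a b ->
  (forall t, a <= t <= b -> Cmod (f t) <= M) ->
  Cmod (CInt f a b) <= (b - a) * M.
Proof.
  intros Hab Hf HM.
  rewrite <- norm_C_R.
  apply (norm_RInt_le_const (V:=C_R_NormedModule) f a b).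
  - exact Hab.
  - intros x Hx. rewrite norm_C_R. now apply HM.
  - now apply CInt_correct.
Qed.

Lemma CInt_derive (f df : R -> C) (a b : R) :
  (forall t, Rmin a b <= t <= Rmax a b -> @is_derive R_AbsRing C_R_NormedModule f t (df t)) ->
  continuous_between df a b ->
  CInt df a b = (f b - f a)%C.
Proof.
  intros H1 H2. apply CInt_unique.
  apply (@is_RInt_derive C_R_CompleteNormedModule); assumption.
Qed.

(** * Integrals around rectangles *)

Definition in_rect (a b c d : R) (z : C) : Prop :=
  a <= fst z <= b /\ c <= snd z <= d.

Definition hint (f : C -> C) (a b y : R) : C := CInt (fun x => f (x, y)) a b.
Definition vint (f : C -> C) (x c d : R) : C := CInt (fun y => f (x, y)) c d.

(** The contour integral of f counterclockwise around the boundary: dz is dx on the horizontal sides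
    and i dy on the vertical ones. *)
Definition rect_int (f : C -> C) (a b c d : R) : C :=
  (hint f a b c + Ci * vint f b c d - hint f a b d - Ci * vint f a c d)%C.

Lemma is_derive_horizontal (y t : R) :
  @is_derive R_AbsRing C_R_NormedModule (fun x => (x, y)) t (1, 0)%R.
Proof. apply is_derive_pair; [apply @is_derive_id | apply @is_derive_const]. Qed.

Lemma is_derive_vertical (x t : R) :
  @is_derive R_AbsRing C_R_NormedModule (fun y => (x, y)) t (0, 1)%R.
Proof. apply is_derive_pair; [apply @is_derive_const | apply @is_derive_id]. Qed.

Lemma continuous_horizontal (f : C -> C) (y t : R) :
  Ccont f (t, y) -> @continuous R_UniformSpace C_UniformSpace (fun x => f (x, y)) t.
Proof.
  intros H.
  apply (@continuous_comp R_UniformSpace C_UniformSpace C_UniformSpace (fun x => (x, y)) f);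
    [|exact H].
  apply (@ex_derive_continuous R_AbsRing C_R_NormedModule).
  eexists. apply is_derive_horizontal.
Qed.

Lemma continuous_vertical (f : C -> C) (x t : R) :
  Ccont f (x, t) -> @continuous R_UniformSpace C_UniformSpace (fun y => f (x, y)) t.
Proof.
  intros H.
  apply (@continuous_comp R_UniformSpace C_UniformSpace C_UniformSpace (fun y => (x, y)) f);
    [|exact H].
  apply (@ex_derive_continuous R_AbsRing C_R_NormedModule).
  eexists. apply is_derive_vertical.
Qed.

Lemma hint_continuous (f : C -> C) (a b c d a' b' y : R) :
  (forall z, in_rect a b c d z -> Ccont f z) ->
  a <= a' <= b -> a <= b' <= b -> c <= y <= d ->
  continuous_between (fun x => f (x, y)) a' b'.
Proof.
  intros H Ha Hb Hy t Ht. apply continuous_horizontal, H.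
  revert Ht. unfold Rmin, Rmax. unfold in_rect; simpl.
  destruct (Rle_dec a' b'); lra.
Qed.

Lemma vint_continuous (f : C -> C) (a b c d x c' d' : R) :
  (forall z, in_rect a b c d z -> Ccont f z) ->
  a <= x <= b -> c <= c' <= d -> c <= d' <= d ->
  continuous_between (fun y => f (x, y)) c' d'.
Proof.
  intros H Ha Hb Hy t Ht. apply continuous_vertical, H.
  revert Ht. unfold Rmin, Rmax. unfold in_rect; simpl.
  destruct (Rle_dec c' d'); lra.
Qed.

(** The inner sides are traversed twice in opposite directions and cancel. *)
Lemma rect_int_split (f : C -> C) (a m b c n d : R) :
  a <= m <= b -> c <= n <= d ->
  (forall z, in_rect a b c d z -> Ccont f z) ->
  rect_int f a b c d =
  (rect_int f a m c n + rect_int f m b c n + rect_int f a m n d + rect_int f m b n d)%C.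
Proof.
  intros Hm Hn Hf. unfold rect_int.
  assert (Hh : forall y, c <= y <= d -> hint f a b y = (hint f a m y + hint f m b y)%C).
  { intros y Hy. apply CInt_Chasles; eapply hint_continuous; eauto; lra. }
  assert (Hv : forall x, a <= x <= b -> vint f x c d = (vint f x c n + vint f x n d)%C).
  { intros y Hy. apply CInt_Chasles; eapply vint_continuous; eauto; lra. }
  rewrite (Hh c), (Hh d), (Hv a), (Hv b) by lra. ring.
Qed.

Lemma rect_int_minus (f g : C -> C) (a b c d : R) :
  a <= b -> c <= d ->
  (forall z, in_rect a b c d z -> Ccont f z) ->
  (forall z, in_rect a b c d z -> Ccont g z) ->
  rect_int (fun z => (f z - g z)%C) a b c d = (rect_int f a b c d - rect_int g a b c d)%C.
Proof.
  intros Hab Hcd Hf Hg. unfold rect_int, hint, vint.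
  rewrite !CInt_minus by
   (solve [eapply hint_continuous; eauto; lra | eapply vint_continuous; eauto; lra]).
  ring.
Qed.

(** Each side contributes the increment of F between its corners, and the four increments
    telescope. *)
Lemma rect_int_primitive (F f : C -> C) (a b c d : R) :
  a <= b -> c <= d ->
  (forall z, in_rect a b c d z -> is_Cderive F z (f z)) ->
  (forall z, in_rect a b c d z -> Ccont f z) ->
  rect_int f a b c d = 0.
Proof.
  intros Hab Hcd HF Hf.
  assert (Hh : forall y, c <= y <= d -> hint f a b y = (F (b, y) - F (a, y))%C).
  { intros y Hy. apply (CInt_derive (fun x => F (x, y))).
    - intros t Ht. rewrite Rmin_left, Rmax_right in Ht by lra.
      replace (f (t, y)) with ((1,0)%R * f (t, y))%C.
      + apply (is_derive_Cderive_comp F (fun x => (x, y))).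
        apply HF. unfold in_rect; simpl; lra.
        apply is_derive_horizontal.
      + apply C_eq; simpl; ring.
    - eapply hint_continuous; eauto; lra. }
  assert (Hv : forall x, a <= x <= b -> (Ci * vint f x c d = F (x, d) - F (x, c))%C).
  { intros x Hx. unfold vint.
    assert (Hc : continuous_between (fun y => f (x, y)) c d) by (eapply vint_continuous; eauto;
      lra).
    apply CInt_correct in Hc.
    apply (is_CInt_mult Ci) in Hc. rewrite <- (CInt_unique _ _ _ _ Hc).
    apply (CInt_derive (fun y => F (x, y))).
    - intros t Ht. rewrite Rmin_left, Rmax_right in Ht by lra.
      apply (is_derive_Cderive_comp F (fun y => (x, y))).
      apply HF. unfold in_rect; simpl; lra.
      apply is_derive_vertical.
    - intros t Ht.
      apply (@continuous_comp R_UniformSpace C_UniformSpace C_UniformSpace (fun y => f (x,y))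
        (fun z => Ci * z)%C).
      + revert t Ht. change (continuous_between (fun y => f (x, y)) c d). eapply vint_continuous;
          eauto; lra.
      + apply (is_Cderive_continuous _ _ Ci), is_Cderive_eps.
        intros eps. exists eps. intros w _.
        match goal with |- Cmod ?e <= _ => replace e with (RtoC 0) by ring end.
        rewrite Cmod_0. apply Rmult_le_pos. apply Rlt_le, eps. apply Cmod_ge_0. }
  unfold rect_int. rewrite (Hh c), (Hh d), (Hv a), (Hv b) by lra. ring.
Qed.

Lemma Cmod_rect_int_le (f : C -> C) (a b c d M : R) :
  a <= b -> c <= d ->
  (forall z, in_rect a b c d z -> Ccont f z) ->
  (forall z, in_rect a b c d z -> Cmod (f z) <= M) ->
  Cmod (rect_int f a b c d) <= 2 * ((b - a) + (d - c)) * M.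
Proof.
  intros Hab Hcd Hf HM.
  assert (Hh : forall y, c <= y <= d -> Cmod (hint f a b y) <= (b - a) * M).
  { intros y Hy. apply Cmod_CInt_le; trivial.
    eapply hint_continuous; eauto; lra.
    intros t Ht. apply HM. unfold in_rect; simpl; lra. }
  assert (Hv : forall x, a <= x <= b -> Cmod (Ci * vint f x c d) <= (d - c) * M).
  { intros x Hx. rewrite Cmod_mult, Cmod_Ci, Rmult_1_l. apply Cmod_CInt_le; trivial.
    eapply vint_continuous; eauto; lra.
    intros t Ht. apply HM. unfold in_rect; simpl; lra. }
  unfold rect_int, Cminus.
  eapply Rle_trans; [apply Cmod_triangle|]. rewrite Cmod_opp.
  eapply Rle_trans; [apply Rplus_le_compat_r, Cmod_triangle|]. rewrite Cmod_opp.
  eapply Rle_trans; [apply Rplus_le_compat_r, Rplus_le_compat_r, Cmod_triangle|].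
  assert (H1 := Hh c). assert (H2 := Hh d). assert (H3 := Hv a). assert (H4 := Hv b).
  lra.
Qed.

(** An induction principle of compactness type: if P failed, some quarter of each failing rectangle
    would fail too, and the nested failing rectangles would shrink to a point at which the local
    hypothesis gives P. *)
Lemma rect_bisection (P : R -> R -> R -> R -> Prop) (a b c d : R) :
  a <= b -> c <= d ->
  (forall a' b' c' d', a <= a' -> a' <= b' -> b' <= b -> c <= c' -> c' <= d' -> d' <= d ->
    let m := (a' + b') / 2 in let n := (c' + d') / 2 in
    P a' m c' n -> P m b' c' n -> P a' m n d' -> P m b' n d' -> P a' b' c' d') ->
  (forall z, in_rect a b c d z -> exists delta : posreal,
    forall a' b' c' d', a <= a' -> a' <= b' -> b' <= b -> c <= c' -> c' <= d' -> d' <= d ->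
      in_rect a' b' c' d' z -> b' - a' < delta -> d' - c' < delta -> P a' b' c' d') ->
  P a b c d.
Proof.
  intros Hab Hcd Hsplit Hloc.
  destruct (classic (P a b c d)) as [HP|HP]; [exact HP|exfalso].
  set (Q := fun q : (R * R) * (R * R) =>
    a <= fst (fst q) /\ fst (fst q) <= snd (fst q) /\ snd (fst q) <= b /\
    c <= fst (snd q) /\ fst (snd q) <= snd (snd q) /\ snd (snd q) <= d /\
    ~ P (fst (fst q)) (snd (fst q)) (fst (snd q)) (snd (snd q))).
  assert (Hstep : forall q : {q | Q q}, exists q' : {q | Q q},
    fst (fst (proj1_sig q)) <= fst (fst (proj1_sig q')) /\
    snd (fst (proj1_sig q')) <= snd (fst (proj1_sig q)) /\
    fst (snd (proj1_sig q)) <= fst (snd (proj1_sig q')) /\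
    snd (snd (proj1_sig q')) <= snd (snd (proj1_sig q)) /\
    snd (fst (proj1_sig q')) - fst (fst (proj1_sig q')) =
      (snd (fst (proj1_sig q)) - fst (fst (proj1_sig q))) / 2 /\
    snd (snd (proj1_sig q')) - fst (snd (proj1_sig q')) =
      (snd (snd (proj1_sig q)) - fst (snd (proj1_sig q))) / 2).
  { intros [[[a' b'] [c' d']] (H1 & H2 & H3 & H4 & H5 & H6 & H7)]. simpl in *.
    set (m := (a' + b') / 2). set (n := (c' + d') / 2).
    assert (Hm : m = (a' + b') / 2) by reflexivity.
    assert (Hn : n = (c' + d') / 2) by reflexivity.
    assert (Hch : forall a1 b1 c1 d1, a' <= a1 -> b1 <= b' -> b1 - a1 = (b' - a') / 2 ->
      c' <= c1 -> d1 <= d' -> d1 - c1 = (d' - c') / 2 ->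
      ~ P a1 b1 c1 d1 ->
      exists q' : {q : R * R * (R * R) | Q q},
       a' <= fst (fst (proj1_sig q')) /\
       snd (fst (proj1_sig q')) <= b' /\
       c' <= fst (snd (proj1_sig q')) /\
       snd (snd (proj1_sig q')) <= d' /\
       snd (fst (proj1_sig q')) - fst (fst (proj1_sig q')) = (b' - a') / 2 /\
       snd (snd (proj1_sig q')) - fst (snd (proj1_sig q')) = (d' - c') / 2).
    { intros a1 b1 c1 d1 G1 G2 G3 G4 G5 G6 G7.
      assert (HQ : Q ((a1, b1), (c1, d1))).
      { unfold Q; simpl. repeat split; trivial; lra. }
      exists (exist _ _ HQ). simpl. repeat split; trivial. }
    (* If no quarter could be chosen, P would hold on all four of them, hence on the rectangle
       itself. *)
    apply NNPP. intros Hn4. apply H7. apply Hsplit; trivial; fold m n; apply NNPP; intros HP';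
    apply Hn4; eapply Hch; try exact HP'; lra. }
  assert (HQ0 : Q ((a, b), (c, d))).
  { unfold Q; simpl. repeat split; trivial; lra. }
  (* Choosing on the sigma type keeps failure and nesting as part of the state, so the sequence is a
     plain iteration. *)
  set (step := fun q => proj1_sig (constructive_indefinite_description _ (Hstep q))).
  set (s := fix s n := match n with O => exist _ _ HQ0 | S n => step (s n) end).
  assert (Hs : forall n, s (S n) = step (s n)) by reflexivity.
  set (A := fun n => fst (fst (proj1_sig (s n)))). set (B :=
    fun n => snd (fst (proj1_sig (s n)))).
  set (X := fun n => fst (snd (proj1_sig (s n)))). set (Y :=
    fun n => snd (snd (proj1_sig (s n)))).
  assert (Hprop : forall n, A n <= A (S n) /\ B (S n) <= B n /\ X n <= X (S n) /\ Y (S n) <=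
    Y n /\
    B (S n) - A (S n) = (B n - A n) / 2 /\ Y (S n) - X (S n) = (Y n - X n) / 2).
  { intros n. unfold A, B, X, Y. rewrite Hs. unfold step.
    destruct (constructive_indefinite_description _ (Hstep (s n))) as [q' Hq']. exact Hq'. }
  assert (HQ : forall n, a <= A n /\ A n <= B n /\ B n <= b /\ c <= X n /\ X n <= Y n /\ Y n <=
    d /\
     ~ P (A n) (B n) (X n) (Y n)).
  { intros n. exact (proj2_sig (s n)). }
  assert (HBA : forall n, B n - A n = (b - a) * (/ 2) ^ n).
  { induction n. unfold A, B; simpl; ring.
    destruct (Hprop n) as (_ & _ & _ & _ & H & _). rewrite H, IHn. simpl. field. }
  assert (HYX : forall n, Y n - X n = (d - c) * (/ 2) ^ n).
  { induction n. unfold X, Y; simpl; ring.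
    destruct (Hprop n) as (_ & _ & _ & _ & _ & H). rewrite H, IHn. simpl. field. }
  assert (Hlim : forall k, is_lim_seq (fun n => k * (/ 2) ^ n) 0).
  { intros k. replace (Finite 0) with (Rbar_mult (Finite k) (Finite 0)) by (simpl; f_equal; ring).
    apply is_lim_seq_scal_l, is_lim_seq_geom. rewrite Rabs_pos_eq; lra. }
  destruct (ex_lim_seq_adj A B) as ([x Hx] & [x' Hx'] & Hxx);
    [apply Hprop | apply Hprop | eapply is_lim_seq_ext; [intros n; symmetry;
      apply HBA | apply Hlim] |].
  rewrite (is_lim_seq_unique _ _ Hx), (is_lim_seq_unique _ _ Hx') in Hxx. injection Hxx as <-.
  destruct (ex_lim_seq_adj X Y) as ([y Hy] & [y' Hy'] & Hyy);
    [apply Hprop | apply Hprop | eapply is_lim_seq_ext; [intros n; symmetry;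
      apply HYX | apply Hlim] |].
  rewrite (is_lim_seq_unique _ _ Hy), (is_lim_seq_unique _ _ Hy') in Hyy. injection Hyy as <-.
  assert (Hxn : forall n, A n <= x <= B n).
  { intros n. split.
    - apply (is_lim_seq_incr_compare A x Hx). apply Hprop.
    - apply (is_lim_seq_decr_compare B x Hx'). apply Hprop. }
  assert (Hyn : forall n, X n <= y <= Y n).
  { intros n. split.
    - apply (is_lim_seq_incr_compare X y Hy). apply Hprop.
    - apply (is_lim_seq_decr_compare Y y Hy'). apply Hprop. }
  destruct (Hloc (x, y)) as [delta Hdelta].
  { unfold in_rect; simpl. assert (G1 := HQ O). assert (G2 := Hxn O). assert (G3 := Hyn O). lra. }
  assert (Hev : forall k, exists N, forall n, (N <= n)%nat -> k * (/ 2) ^ n < delta).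
  { intros k. destruct (proj2 (is_lim_seq_spec _ _) (Hlim k) delta) as [N HN] ||
     destruct (proj1 (is_lim_seq_spec _ _) (Hlim k) delta) as [N HN].
    exists N. intros n Hn. specialize (HN n Hn). apply Rabs_def2 in HN. lra. }
  destruct (Hev (b - a)) as [N1 HN1]. destruct (Hev (d - c)) as [N2 HN2].
  set (n := (N1 + N2)%nat).
  destruct (HQ n) as (G1 & G2 & G3 & G4 & G5 & G6 & G7). apply G7.
  apply Hdelta; trivial.
  - split; simpl; [apply Hxn | apply Hyn].
  - rewrite HBA. apply HN1. unfold n; lia.
  - rewrite HYX. apply HN2. unfold n; lia.
Qed.

(** Polynomials, 1 / (w - v) and Cauchy integrals all have a remainder of second order, so this
    criterion replaces eps-delta arguments for them. *)
Lemma is_Cderive_quadratic_error (f : C -> C) (z l : C) (K : R) (delta : posreal) :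
  (forall w, Cmod (w - z) < delta ->
    Cmod (f w - f z - (w - z) * l) <= K * Cmod (w - z) ^ 2) ->
  is_Cderive f z l.
Proof.
  intros H. apply is_Cderive_eps. intros eps.
  (* K may be zero or negative; |K| + 1 is a positive substitute to divide by. *)
  assert (HK : 0 < Rabs K + 1) by (assert (G := Rabs_pos K); lra).
  assert (Hd : 0 < Rmin delta (eps / (Rabs K + 1))).
  { apply Rmin_pos; [apply delta|]. apply Rdiv_lt_0_compat; [apply eps|exact HK]. }
  exists (mkposreal _ Hd). simpl. intros w Hw.
  assert (H1 := Rmin_l delta (eps / (Rabs K + 1))).
  assert (H2 := Rmin_r delta (eps / (Rabs K + 1))).
  eapply Rle_trans; [apply H; lra|].
  assert (H0 := Cmod_ge_0 (w - z)).
  replace (K * Cmod (w - z) ^ 2) with (K * Cmod (w - z) * Cmod (w - z)) by ring.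
  apply Rmult_le_compat_r; [exact H0|].
  apply Rle_trans with ((Rabs K + 1) * (eps / (Rabs K + 1))).
  - apply Rle_trans with ((Rabs K + 1) * Cmod (w - z)).
    + apply Rmult_le_compat_r; [exact H0|]. assert (G := Rle_abs K). lra.
    + apply Rmult_le_compat_l; lra.
  - right. field. lra.
Qed.

Lemma is_Cderive_affine (k l z w : C) : is_Cderive (fun w => (k + (w - z) * l)%C) w l.
Proof.
  apply is_Cderive_quadratic_error with (K := 0) (delta := mkposreal 1 Rlt_0_1).
  intros w' _. match goal with |- Cmod ?e <= _ => replace e with (RtoC 0) by ring end.
  rewrite Cmod_0. lra.
Qed.

Lemma rect_int_affine (k l z : C) (a b c d : R) :
  a <= b -> c <= d -> rect_int (fun w => (k + (w - z) * l)%C) a b c d = 0.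
Proof.
  intros Hab Hcd.
  apply rect_int_primitive with (fun w => (w * k + (w - z) * (w - z) / 2 * l)%C); trivial.
  - intros w _. apply is_Cderive_quadratic_error with (K := Cmod (/ 2 * l)) (delta :=
      mkposreal 1 Rlt_0_1).
    intros w' _. right. rewrite <- Cmod_pow, <- Cmod_mult. f_equal. simpl. field.
  - intros w _. eapply is_Cderive_continuous, is_Cderive_affine.
Qed.

(** Near each point f is affine up to o(|w - z|). Affine functions have primitives and integrate to
    zero, so a small rectangle contributes at most eps times the square of its half-perimeter;
    [rect_bisection] carries this bound to the whole rectangle. *)
Lemma goursat (f : C -> C) (a b c d : R) :
  a <= b -> c <= d ->
  (forall z, in_rect a b c d z -> exists l, is_Cderive f z l) ->
  rect_int f a b c d = 0.
Proof.
  intros Hab Hcd Hf.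
  assert (Hcont : forall z, in_rect a b c d z -> Ccont f z).
  { intros z Hz. destruct (Hf z Hz) as [l Hl]. eapply is_Cderive_continuous, Hl. }
  assert (Hsub : forall a' b' c' d', a <= a' -> b' <= b -> c <= c' -> d' <= d ->
    forall z, in_rect a' b' c' d' z -> in_rect a b c d z).
  { intros a' b' c' d' H1 H2 H3 H4 z [H5 H6]. split; lra. }
  assert (Heps : forall eps : posreal,
    Cmod (rect_int f a b c d) <= eps * ((b - a) + (d - c)) ^ 2).
  { (* Bisection divides the square of the half-perimeter by exactly 4, so this bound is
       inherited from the four quarters. *)
    intros eps.
    apply (rect_bisection (fun a b c d =>
       Cmod (rect_int f a b c d) <= eps * ((b - a) + (d - c)) ^ 2)); trivial.
    - intros a' b' c' d' H1 H2 H3 H4 H5 H6 m n P1 P2 P3 P4.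
      rewrite (rect_int_split f a' m b' c' n d');
        [ | unfold m; lra | unfold n; lra | intros z Hz; apply Hcont; revert Hz; apply Hsub; lra].
      eapply Rle_trans; [apply Cmod_triangle|].
      eapply Rle_trans; [apply Rplus_le_compat_r, Cmod_triangle|].
      eapply Rle_trans; [apply Rplus_le_compat_r, Rplus_le_compat_r, Cmod_triangle|].
      eapply Rle_trans; [apply Rplus_le_compat; [apply Rplus_le_compat;
        [apply Rplus_le_compat|]|]; eassumption|].
      right. unfold m, n. field.
    - intros z Hz. destruct (Hf z Hz) as [l Hl].
      assert (He : 0 < eps / 2) by (destruct eps; simpl; lra).
      destruct (proj1 (is_Cderive_eps f z l) Hl (mkposreal _ He)) as [delta Hdelta].
      assert (Hd2 : 0 < delta / 2) by (destruct delta; simpl; lra).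
      exists (mkposreal _ Hd2). simpl.
      intros a' b' c' d' H1 H2 H3 H4 H5 H6 Hz' Hb Hd.
      set (A := fun w => (f z + (w - z) * l)%C).
      assert (HA : forall w, Ccont A w).
      { intros w. eapply is_Cderive_continuous, is_Cderive_affine. }
      replace (rect_int f a' b' c' d') with (rect_int (fun w => (f w - A w)%C) a' b' c' d').
      (* The boundary is twice as long as the half-perimeter, so a remainder of at most eps / 2
         times the half-perimeter yields exactly eps times its square. *)
      + eapply Rle_trans; [apply Cmod_rect_int_le with (M := eps / 2 * ((b' - a') + (d' - c')));
          trivial|].
        * intros w Hw. apply (@continuous_minus C_UniformSpace R_AbsRing C_R_NormedModule f A).
          apply Hcont. revert Hw. now apply Hsub. apply HA.
        * intros w Hw.
          assert (Hwz : Cmod (w - z) <= (b' - a') + (d' - c')).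
          { eapply Rle_trans; [apply Cmod_le_sum|]. destruct Hw, Hz'. simpl.
            apply Rplus_le_compat; apply Rabs_le; lra. }
          replace (f w - A w)%C with (f w - f z - (w - z) * l)%C by (unfold A; ring).
          eapply Rle_trans; [apply Hdelta; lra|]. simpl.
          apply Rmult_le_compat_l; lra.
        * right. field.
      + rewrite rect_int_minus; trivial.
        * unfold A. rewrite rect_int_affine by trivial. ring.
        * intros w Hw. apply Hcont. revert Hw. now apply Hsub. }
  apply Cmod_eq_0, Rle_antisym; [|apply Cmod_ge_0].
  apply le_epsilon. intros e He. rewrite Rplus_0_l.
  set (S := ((b - a) + (d - c)) ^ 2) in *.
  assert (HS : 0 <= S) by apply pow2_ge_0.
  (* S vanishes when the rectangle is a point, hence S + 1. *)
  assert (He' : 0 < e / (S + 1)) by (apply Rdiv_lt_0_compat; lra).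
  eapply Rle_trans; [apply (Heps (mkposreal _ He'))|]. simpl.
  apply Rle_trans with (e / (S + 1) * (S + 1)); [apply Rmult_le_compat_l; lra|].
  right. field. lra.
Qed.

(** * Primitives on a square *)

Definition in_square (z0 : C) (r : R) (z : C) : Prop :=
  Rabs (fst z - fst z0) < r /\ Rabs (snd z - snd z0) < r.

(** In the construction of a primitive the corners come in any order; exchanging two sides only
    changes the sign of the integral. *)
Lemma rect_int_eq_0_unordered (f : C -> C) (a b c d : R) :
  (forall z, in_rect (Rmin a b) (Rmax a b) (Rmin c d) (Rmax c d) z ->
     exists l, is_Cderive f z l) ->
  rect_int f a b c d = 0.
Proof.
  intros Hf.
  assert (Hcont : forall z, in_rect (Rmin a b) (Rmax a b) (Rmin c d) (Rmax c d) z -> Ccont f z).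
  { intros z Hz. destruct (Hf z Hz) as [l Hl]. eapply is_Cderive_continuous, Hl. }
  assert (Hma := Rmin_l a b). assert (Hmb := Rmin_r a b).
  assert (HMa := Rmax_l a b). assert (HMb := Rmax_r a b).
  assert (Hmc := Rmin_l c d). assert (Hmd := Rmin_r c d).
  assert (HMc := Rmax_l c d). assert (HMd := Rmax_r c d).
  assert (Hh : forall y, Rmin c d <= y <= Rmax c d -> hint f b a y = (- hint f a b y)%C).
  { intros y Hy. apply CInt_swap. eapply hint_continuous; eauto; lra. }
  assert (Hv : forall x, Rmin a b <= x <= Rmax a b -> vint f x d c = (- vint f x c d)%C).
  { intros x Hx. apply CInt_swap. eapply vint_continuous; eauto; lra. }
  assert (G : rect_int f (Rmin a b) (Rmax a b) (Rmin c d) (Rmax c d) = 0).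
  { apply goursat; trivial; lra. }
  assert (Hhc := Hh c). assert (Hhd := Hh d). assert (Hva := Hv a). assert (Hvb := Hv b).
  revert G. unfold rect_int, Rmin, Rmax in *.
  destruct (Rle_dec a b); destruct (Rle_dec c d); intros G; trivial;
  try rewrite Hhc in G by lra; try rewrite Hhd in G by lra;
  try rewrite Hva in G by lra; try rewrite Hvb in G by lra;
  [ rewrite <- (Copp_0), <- G | rewrite <- (Copp_0), <- G | rewrite <- G]; ring.
Qed.

(** F integrates f from the centre first horizontally, then vertically; a square contains every such
    path and every rectangle spanned by two of them. By Goursat's theorem the increment of F from p
    to q is the integral along the horizontal-then-vertical path from p to q, which is short and
    close to p. *)
Lemma primitive_on_square (f : C -> C) (z0 : C) (r : R) :
  (forall z, in_square z0 r z -> exists l, is_Cderive f z l) ->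
  exists F, forall z, in_square z0 r z -> is_Cderive F z (f z).
Proof.
  intros Hf.
  destruct z0 as [x0 y0].
  assert (Hcont : forall z, in_square (x0, y0) r z -> Ccont f z).
  { intros z Hz. destruct (Hf z Hz) as [l Hl]. eapply is_Cderive_continuous, Hl. }
  exists (fun z => (hint f x0 (fst z) y0 + Ci * vint f (fst z) y0 (snd z))%C).
  intros [px py] [Hx Hy]. simpl in Hx, Hy.
  assert (Hr : 0 < r) by (assert (G := Rabs_pos (px - x0)); lra).
  apply Rabs_def2 in Hx. apply Rabs_def2 in Hy.
  apply is_Cderive_eps. intros eps.
  assert (Hc : Ccont f (px, py)).
  { apply Hcont. split; apply Rabs_def1; simpl; lra. }
  assert (He : 0 < eps / 2) by (destruct eps; simpl; lra).
  assert (Hev : exists delta : posreal, forall w, Cmod (w - (px, py)) < delta ->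
    Cmod (f w - f (px, py)) <= eps / 2).
  { assert (Hloc : @locally C_UniformSpace (f (px, py)) (fun w => Cmod (w - f (px,
      py)) <= eps / 2)).
    { apply (proj2 (locally_Cmod _ _)). exists (mkposreal _ He). intros w Hw. simpl in Hw. lra. }
    apply Hc in Hloc. apply (proj1 (locally_Cmod _ _)) in Hloc. exact Hloc. }
  destruct Hev as [delta Hdelta].
  (* The distance from p to the nearest of the four sides of the square. *)
  set (rho := Rmin (Rmin (r - (px - x0)) (r + (px - x0))) (Rmin (r - (py - y0)) (r + (py - y0)))).
  assert (Hrho : 0 < Rmin (delta / 2) rho).
  { unfold rho. repeat apply Rmin_pos; try lra. destruct delta; simpl; lra. }
  exists (mkposreal _ Hrho). simpl. intros [qx qy] Hq.
  assert (R1 := Rmin_l (delta / 2) rho). assert (R2 := Rmin_r (delta / 2) rho).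
  assert (R3 := Rmin_l (Rmin (r - (px - x0)) (r + (px - x0))) (Rmin (r - (py - y0)) (r +
    (py - y0)))).
  assert (R4 := Rmin_r (Rmin (r - (px - x0)) (r + (px - x0))) (Rmin (r - (py - y0)) (r +
    (py - y0)))).
  assert (R5 := Rmin_l (r - (px - x0)) (r + (px - x0))). assert (R6 :=
    Rmin_r (r - (px - x0)) (r + (px - x0))).
  assert (R7 := Rmin_l (r - (py - y0)) (r + (py - y0))). assert (R8 :=
    Rmin_r (r - (py - y0)) (r + (py - y0))).
  fold rho in R3, R4.
  assert (Hqx := fst_le_Cmod ((qx, qy) - (px, py))). assert (Hqy := snd_le_Cmod ((qx, qy) - (px,
    py))).
  set (D := Cmod ((qx, qy) - (px, py))) in *. simpl in Hqx, Hqy.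
  assert (Hqx1 := Rle_abs (qx + - px)). assert (Hqx2 := Rle_abs (- (qx + - px))).
  assert (Hqy1 := Rle_abs (qy + - py)). assert (Hqy2 := Rle_abs (- (qy + - py))).
  rewrite Rabs_Ropp in Hqx2, Hqy2.
  assert (Hin : forall x y, Rmin px qx <= x <= Rmax px qx ->
    Rmin y0 (Rmin py qy) <= y <= Rmax y0 (Rmax py qy) ->
     in_square (x0, y0) r (x, y)).
  { intros x y Hxx Hyy. split; apply Rabs_def1; simpl; revert Hxx Hyy; unfold Rmin, Rmax;
    repeat destruct Rle_dec; lra. }
  assert (Hinx : forall x, Rmin x0 (Rmin px qx) <= x <= Rmax x0 (Rmax px qx) -> in_square (x0,
    y0) r (x, y0)).
  { intros x Hxx. split; apply Rabs_def1; simpl; revert Hxx; unfold Rmin, Rmax;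
    repeat destruct Rle_dec; lra. }
  assert (HG : rect_int f px qx y0 py = 0).
  { apply rect_int_eq_0_unordered. intros [x y] [Hxx Hyy]. apply Hf, Hin; [exact Hxx|].
    simpl in Hyy. revert Hyy. unfold Rmin, Rmax; repeat destruct Rle_dec; lra. }
  assert (Hch : hint f x0 qx y0 = (hint f x0 px y0 + hint f px qx y0)%C).
  { apply CInt_Chasles; intros t Ht; apply continuous_horizontal, Hcont, Hinx; revert Ht;
    unfold Rmin, Rmax; repeat destruct Rle_dec; lra. }
  assert (Hcv : vint f qx y0 qy = (vint f qx y0 py + vint f qx py qy)%C).
  { apply CInt_Chasles; intros t Ht; apply continuous_vertical, Hcont, Hin; revert Ht;
    unfold Rmin, Rmax; repeat destruct Rle_dec; lra. }
  assert (Hcb : continuous_between (fun x => f (x, py)) px qx).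
  { intros t Ht. apply continuous_horizontal, Hcont, Hin; trivial. unfold Rmin, Rmax;
      repeat destruct Rle_dec; lra. }
  assert (Hcb' : continuous_between (fun y => f (qx, y)) py qy).
  { intros t Ht. apply continuous_vertical, Hcont, Hin; revert Ht; unfold Rmin, Rmax;
      repeat destruct Rle_dec; lra. }
  assert (Hconst : forall a b k, continuous_between (fun _ => k) a b).
  { intros a b k t _. apply (@continuous_const R_UniformSpace C_UniformSpace). }
  assert (Hbound : forall (g : R -> C) a b, continuous_between g a b ->
     (forall t, Rmin a b <= t <= Rmax a b -> Cmod (g t) <= eps / 2) -> Rabs (b - a) <= D ->
     Cmod (CInt g a b) <= D * (eps / 2)).
  { intros g a b Hg HM HD.
    destruct (Rle_lt_dec a b) as [Hab|Hab].
    - rewrite Rmin_left, Rmax_right in HM by lra.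
      eapply Rle_trans; [apply Cmod_CInt_le with (M := eps / 2); trivial|].
      rewrite Rabs_pos_eq in HD by lra. apply Rmult_le_compat_r; lra.
    - rewrite Rmin_right, Rmax_left in HM by lra.
      assert (Hg' : continuous_between g b a).
      { intros t Ht. apply Hg. rewrite Rmin_comm, Rmax_comm. exact Ht. }
      rewrite (CInt_swap g b a), Cmod_opp by trivial.
      eapply Rle_trans; [apply Cmod_CInt_le with (M := eps / 2); trivial; lra|].
      rewrite Rabs_left in HD by lra. apply Rmult_le_compat_r; lra. }
  assert (E1 : (CInt (fun x => f (x, py) - f (px,
    py))%C px qx = hint f px qx py - RtoC (qx - px) * f (px, py))%C).
  { rewrite CInt_minus, CInt_const; trivial. }
  assert (E2 : (CInt (fun y => f (qx, y) - f (px,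
    py))%C py qy = vint f qx py qy - RtoC (qy - py) * f (px, py))%C).
  { rewrite CInt_minus, CInt_const; trivial. }
  simpl fst; simpl snd. rewrite Hch, Hcv.
  (* The paths to p and to q differ by the boundary of the rectangle with corners (px, y0) and (qx,
     py), followed by the two legs from p through (qx, py) to q; subtracting the constant f p on
     each leg accounts for (q - p) f p. *)
  match goal with |- Cmod ?e <= _ => replace e with
    (CInt (fun x => f (x, py) - f (px, py))%C px qx + Ci * CInt (fun y => f (qx, y) - f (px,
      py))%C py qy + rect_int f px qx y0 py)%C end.
  - rewrite HG, Cplus_0_r.
    eapply Rle_trans; [apply Cmod_triangle|]. rewrite Cmod_mult, Cmod_Ci, Rmult_1_l.
    apply Rle_trans with (D * (eps / 2) + D * (eps / 2)); [|right; field].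
    apply Rplus_le_compat; apply Hbound.
    + intros t Ht. apply (@continuous_minus R_UniformSpace R_AbsRing C_R_NormedModule).
      apply Hcb, Ht. apply (Hconst px qx), Ht.
    + intros t Ht. apply Hdelta. eapply Rle_lt_trans; [apply Cmod_le_sum|]. simpl.
      replace (Rabs (py + - py)) with 0 by (rewrite Rplus_opp_r, Rabs_R0; reflexivity).
      assert (Rabs (t + - px) <= Rabs (qx + - px)); [|lra].
      revert Ht. unfold Rmin, Rmax, Rabs; repeat destruct Rle_dec; repeat destruct Rcase_abs; lra.
    + exact Hqx.
    + intros t Ht. apply (@continuous_minus R_UniformSpace R_AbsRing C_R_NormedModule).
      apply Hcb', Ht. apply (Hconst py qy), Ht.
    + intros t Ht. apply Hdelta. eapply Rle_lt_trans; [apply Cmod_le_sum|]. simpl.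
      assert (Rabs (t + - py) <= Rabs (qy + - py)); [|lra].
      revert Ht. unfold Rmin, Rmax, Rabs; repeat destruct Rle_dec; repeat destruct Rcase_abs; lra.
    + exact Hqy.
  - rewrite E1, E2. unfold rect_int.
    replace ((qx, qy) - (px, py))%C with (RtoC (qx - px) + Ci * RtoC (qy - py))%C.
    + ring.
    + apply C_eq; simpl; ring.
Qed.

(** * Cauchy's integral formula *)

Lemma is_derive_segment (z k : C) (t : R) :
  @is_derive R_AbsRing C_R_NormedModule (fun t => (z + RtoC t * k)%C) t k.
Proof.
  destruct z as [x y], k as [k1 k2].
  apply (is_derive_ext (fun t => (x + t * k1, y + t * k2))).
  - intros s. apply C_eq; simpl; ring.
  - apply is_derive_pair; auto_derive; trivial; ring.
Qed.

(** The mean value inequality is applied to the real and imaginary parts along the segment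
    separately, whence the factor 2. *)
Lemma Cmod_increment_le (f df : C -> C) (z w : C) (M : R) :
  (forall v, Cmod (v - z) <= Cmod (w - z) -> is_Cderive f v (df v) /\ Cmod (df v) <= M) ->
  Cmod (f w - f z) <= 2 * M * Cmod (w - z).
Proof.
  intros H.
  set (p := fun t => (z + RtoC t * (w - z))%C).
  assert (Hd : forall t, Rabs (t - 0) <= Rabs (1 - 0) ->
    @is_derive R_AbsRing C_R_NormedModule (fun s => f (p s)) t ((w - z) * df (p t))%C /\
    Cmod ((w - z) * df (p t)) <= M * Cmod (w - z)).
  { intros t Ht. rewrite !Rminus_0_r, Rabs_R1 in Ht.
    destruct (H (p t)) as [H1 H2].
    - unfold p. replace (z + RtoC t * (w - z) - z)%C with (RtoC t * (w - z))%C by ring.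
      rewrite Cmod_mult, Cmod_R. assert (G := Cmod_ge_0 (w - z)). nra.
    - split.
      + apply is_derive_Cderive_comp; trivial. apply is_derive_segment.
      + rewrite Cmod_mult, Rmult_comm. apply Rmult_le_compat_r; trivial. apply Cmod_ge_0. }
  assert (G1 := bounded_variation (fun s => fst (f (p s))) (fun s => fst ((w - z) * df (p s))%C)
    (M * Cmod (w - z)) 0 1).
  assert (G2 := bounded_variation (fun s => snd (f (p s))) (fun s => snd ((w - z) * df (p s))%C)
    (M * Cmod (w - z)) 0 1).
  assert (P0 : p 0 = z) by (unfold p; ring). assert (P1 : p 1 = w) by (unfold p; ring).
  cbv beta in G1, G2. rewrite P0, P1, Rminus_0_r, Rabs_R1 in G1, G2.
  eapply Rle_trans; [apply Cmod_le_sum|].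
  apply Rle_trans with (M * Cmod (w - z) * 1 + M * Cmod (w - z) * 1); [|right; ring].
  apply Rplus_le_compat.
  - apply G1. intros t Ht. destruct (Hd t) as [H1 H2]. { rewrite (Rminus_0_r 1), Rabs_R1;
      exact Ht. }
    split. apply is_derive_fst, H1. eapply Rle_trans; [apply fst_le_Cmod | exact H2].
  - apply G2. intros t Ht. destruct (Hd t) as [H1 H2]. { rewrite (Rminus_0_r 1), Rabs_R1;
      exact Ht. }
    split. apply is_derive_snd, H1. eapply Rle_trans; [apply snd_le_Cmod | exact H2].
Qed.

Lemma is_Cderive_mult (f g : C -> C) (z lf lg : C) :
  is_Cderive f z lf -> is_Cderive g z lg ->
  is_Cderive (fun w => f w * g w)%C z (lf * g z + f z * lg)%C.
Proof.
  intros Hf Hg. apply is_Cderive_AbsRing in Hf, Hg. apply is_Cderive_AbsRing.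
  apply (@is_derive_mult C_AbsRing f g z lf lg Hf Hg). apply Cmult_comm.
Qed.

Lemma is_Cderive_minus (f g : C -> C) (z lf lg : C) :
  is_Cderive f z lf -> is_Cderive g z lg ->
  is_Cderive (fun w => f w - g w)%C z (lf - lg)%C.
Proof. apply @is_derive_minus. Qed.

Lemma is_Cderive_const (k z : C) : is_Cderive (fun _ => k) z 0.
Proof. apply @is_derive_const. Qed.

Lemma is_Cderive_id (z : C) : is_Cderive (fun w => w) z 1.
Proof. apply is_Cderive_AbsRing. apply @is_derive_id. Qed.

Lemma is_Cderive_ext_loc (f g : C -> C) (z l : C) (delta : posreal) :
  (forall w, Cmod (w - z) < delta -> f w = g w) ->
  is_Cderive f z l -> is_Cderive g z l.
Proof.
  intros H. apply (@is_derive_ext_loc C_AbsRing C_NormedModule).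
  exists delta. exact H.
Qed.

Lemma Cmod_minus_ge (a h : C) : Cmod a - Cmod h <= Cmod (a - h).
Proof.
  assert (G := Cmod_triangle (a - h) h).
  replace (a - h + h)%C with a in G by ring. lra.
Qed.

Lemma Cmod_minus_sym (a b : C) : Cmod (a - b) = Cmod (b - a).
Proof. rewrite <- Cmod_opp. f_equal. ring. Qed.

Lemma C_neq_of_Cmod (z : C) : 0 < Cmod z -> z <> 0.
Proof. apply Cmod_gt_0. Qed.

Lemma is_Cderive_inv_shift (z v : C) :
  z <> v -> is_Cderive (fun w => / (w - v))%C z (- / (z - v) ^ 2)%C.
Proof.
  intros Hz. apply Cminus_eq_contra in Hz.
  assert (Hm : 0 < Cmod (z - v)) by (now apply Cmod_gt_0).
  assert (Hd : 0 < Cmod (z - v) / 2) by lra.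
  (* The remainder is exactly (w - z)^2 / ((w - v) (z - v)^2), and |w - v| is at least |z - v| / 2
     on the chosen disc. *)
  apply is_Cderive_quadratic_error with (K := / (Cmod (z - v) / 2) * / Cmod (z - v) ^ 2)
    (delta := mkposreal _ Hd).
  simpl. intros w Hw.
  assert (Hwv : Cmod (z - v) / 2 <= Cmod (w - v)).
  { assert (G := Cmod_minus_ge (z - v) (z - w)).
    replace (z - v - (z - w))%C with (w - v)%C in G by ring.
    rewrite (Cmod_minus_sym z w) in G. lra. }
  assert (Hw0 : (w - v)%C <> 0) by (apply C_neq_of_Cmod; lra).
  replace (/ (w - v) - / (z - v) - (w - z) * - / ((z - v) * ((z - v) * 1)))%C
    with (/ (w - v) * / (z - v) ^ 2 * (w - z) ^ 2)%C by (simpl; field; auto).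
  rewrite !Cmod_mult, !Cmod_inv, !Cmod_pow by (try apply Cpow_nz; trivial).
  change (Cmod (w - z) * (Cmod (w - z) * 1)) with (Cmod (w - z) ^ 2).
  change (Cmod (z - v) * (Cmod (z - v) * 1)) with (Cmod (z - v) ^ 2).
  apply Rmult_le_compat_r; [apply pow2_ge_0|].
  apply Rmult_le_compat_r; [apply Rlt_le, Rinv_0_lt_compat, pow_lt, Hm|].
  apply Rinv_le_contravar; lra.
Qed.

(** Filling the quotient at w with F'(w) = f w removes the singularity; its derivative there is the
    Taylor coefficient f'(w) / 2. *)
Lemma is_Cderive_difference_quotient (F f : C -> C) (z0 w : C) (r : R) :
  (forall z, in_square z0 r z -> is_Cderive F z (f z)) ->
  (forall z, in_square z0 r z -> exists l, is_Cderive f z l) ->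
  in_square z0 r w ->
  forall z, in_square z0 r z -> exists l, is_Cderive
    (fun z => if Ceq_dec z w then f w else ((F z - F w) / (z - w))%C) z l.
Proof.
  intros HF Hf Hw z Hz.
  destruct (Ceq_dec z w) as [->|Hzw].
  - destruct (Hf w Hw) as [l Hl]. exists (l / 2)%C.
    (* The remainder G below of the second-order expansion of F at w has derivative
       f u - f w - (u - w) l = o(u - w), so it is o((u - w)^2). *)
    apply is_Cderive_eps. intros eps.
    assert (He : 0 < eps / 2) by (destruct eps; simpl; lra).
    destruct (proj1 (is_Cderive_eps f w l) Hl (mkposreal _ He)) as [delta Hdelta].
    simpl in Hdelta.
    destruct Hw as [Hw1 Hw2].
    set (rho := Rmin (r - Rabs (fst w - fst z0)) (r - Rabs (snd w - snd z0))).
    assert (Hrho : 0 < Rmin delta rho).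
    { unfold rho. repeat apply Rmin_pos; try lra. apply delta. }
    exists (mkposreal _ Hrho). simpl. intros v Hv.
    assert (R1 := Rmin_l delta rho). assert (R2 := Rmin_r delta rho).
    assert (R3 := Rmin_l (r - Rabs (fst w - fst z0)) (r - Rabs (snd w - snd z0))).
    assert (R4 := Rmin_r (r - Rabs (fst w - fst z0)) (r - Rabs (snd w - snd z0))).
    fold rho in R3, R4.
    destruct (Ceq_dec w w) as [_|N]; [|congruence].
    destruct (Ceq_dec v w) as [->|Hvw].
    + replace (f w - f w - (w - w) * (l / 2))%C with (RtoC 0) by ring.
      rewrite Cmod_0. apply Rmult_le_pos; [apply Rlt_le, eps | apply Cmod_ge_0].
    + apply Cminus_eq_contra in Hvw.
      assert (Hp : 0 < Cmod (v - w)) by (now apply Cmod_gt_0).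
      set (G := fun u => (F u - (u - w) * (f w + (u - w) * (l / 2)))%C).
      assert (HG : Cmod (G v - G w) <= 2 * (eps / 2 * Cmod (v - w)) * Cmod (v - w)).
      { apply Cmod_increment_le with (fun u => (f u - f w - (u - w) * l)%C).
        intros u Hu.
        assert (Hsq : in_square z0 r u).
        { assert (G1 := fst_le_Cmod (u - w)). assert (G2 := snd_le_Cmod (u - w)). simpl in G1, G2.
          split.
          - replace (fst u - fst z0) with ((fst u + - fst w) + (fst w - fst z0)) by ring.
            eapply Rle_lt_trans; [apply Rabs_triang|]. lra.
          - replace (snd u - snd z0) with ((snd u + - snd w) + (snd w - snd z0)) by ring.
            eapply Rle_lt_trans; [apply Rabs_triang|]. lra. }
        split.
        - unfold G.
          replace (f u - f w - (u - w) * l)%C with (f u - (f w + (u - w) * l))%C by ring.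
          apply is_Cderive_minus; [now apply HF|].
          apply is_Cderive_quadratic_error with (K := Cmod (l / 2)) (delta :=
            mkposreal 1 Rlt_0_1).
          intros u' _. right. rewrite <- Cmod_pow, <- Cmod_mult. f_equal. simpl. field.
        - eapply Rle_trans; [apply Hdelta; lra|]. apply Rmult_le_compat_l; lra. }
      replace ((F v - F w) / (v - w) - f w - (v - w) * (l / 2))%C
        with ((G v - G w) / (v - w))%C by (unfold G; field; trivial).
      rewrite Cmod_div by trivial.
      apply Rmult_le_reg_r with (Cmod (v - w)); [exact Hp|].
      unfold Rdiv. rewrite Rmult_assoc, Rinv_l, Rmult_1_r by lra.
      eapply Rle_trans; [exact HG|]. right. field.
  - exists (f z * / (z - w) + (F z - F w) * - / (z - w) ^ 2)%C.
    assert (Hp : 0 < Cmod (z - w)).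
    { apply Cmod_gt_0. now apply Cminus_eq_contra. }
    (* The disc of radius |z - w| around z does not meet w, so the other branch of the test is the
       only one. *)
    apply (is_Cderive_ext_loc (fun z => (F z - F w) * / (z - w))%C _ _ _ (mkposreal _ Hp)).
    + simpl. intros v Hv. destruct (Ceq_dec v w) as [->|_]; [|reflexivity].
      rewrite Cmod_minus_sym in Hv. lra.
    + apply (is_Cderive_mult (fun z => F z - F w)%C (fun z => / (z - w))%C).
      * rewrite <- (Cplus_0_r (f z)), <- Copp_0. apply is_Cderive_minus;
          [now apply HF|apply is_Cderive_const].
      * now apply is_Cderive_inv_shift.
Qed.

(** * Integrals over circles *)

Definition circle (z0 : C) (rho t : R) : C :=
  (z0 + (rho * cos t, rho * sin t)%R)%C.

Definition circle' (rho t : R) : C := (- rho * sin t, rho * cos t)%R.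

Lemma is_derive_circle (z0 : C) (rho t : R) :
  @is_derive R_AbsRing C_R_NormedModule (circle z0 rho) t (circle' rho t).
Proof.
  destruct z0 as [x y].
  apply (is_derive_ext (fun t => (x + rho * cos t, y + rho * sin t))).
  - intros s. reflexivity.
  - apply is_derive_pair; auto_derive; trivial; ring.
Qed.

Lemma continuous_circle' (rho t : R) :
  @continuous R_UniformSpace C_UniformSpace (circle' rho) t.
Proof.
  apply (@ex_derive_continuous R_AbsRing C_R_NormedModule).
  exists (- rho * cos t, - rho * sin t)%R.
  apply is_derive_pair; auto_derive; trivial; ring.
Qed.

Lemma continuous_Cmult (f g : R -> C) (t : R) :
  @continuous R_UniformSpace C_UniformSpace f t ->
  @continuous R_UniformSpace C_UniformSpace g t ->
  @continuous R_UniformSpace C_UniformSpace (fun s => f s * g s)%C t.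
Proof.
  intros Hf Hg.
  assert (H1 : continuous (fun s => fst (f s)) t).
  { apply (@continuous_comp R_UniformSpace C_UniformSpace R_UniformSpace f fst); trivial.
    destruct (f t); apply continuous_fst. }
  assert (H2 : continuous (fun s => snd (f s)) t).
  { apply (@continuous_comp R_UniformSpace C_UniformSpace R_UniformSpace f snd); trivial.
    destruct (f t); apply continuous_snd. }
  assert (H3 : continuous (fun s => fst (g s)) t).
  { apply (@continuous_comp R_UniformSpace C_UniformSpace R_UniformSpace g fst); trivial.
    destruct (g t); apply continuous_fst. }
  assert (H4 : continuous (fun s => snd (g s)) t).
  { apply (@continuous_comp R_UniformSpace C_UniformSpace R_UniformSpace g snd); trivial.
    destruct (g t); apply continuous_snd. }
  unfold Cmult.
  apply (continuous_comp_2 (fun s => fst (f s) * fst (g s) - snd (f s) * snd (g s))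
    (fun s => fst (f s) * snd (g s) + snd (f s) * fst (g s)) (fun x y => (x, y)) t).
  - apply (@continuous_minus R_UniformSpace R_AbsRing R_NormedModule);
      apply (@continuous_mult R_UniformSpace R_AbsRing); trivial.
  - apply (@continuous_plus R_UniformSpace R_AbsRing R_NormedModule);
      apply (@continuous_mult R_UniformSpace R_AbsRing); trivial.
  - match goal with |- continuous ?h _ =>
      apply (continuous_ext (fun z => z) h) end. intros [a b]; reflexivity. apply continuous_id.
Qed.

Lemma Cmod_circle (z0 : C) (rho t : R) :
  0 < rho -> Cmod (circle z0 rho t - z0) = rho.
Proof.
  intros Hr. unfold circle.
  replace (z0 + ((rho * cos t)%R, (rho * sin t)%R) - z0)%C with ((rho * cos t)%R,
    (rho * sin t)%R) by (apply C_eq; simpl; ring).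
  unfold Cmod; simpl.
  replace (rho * cos t * (rho * cos t * 1) + rho * sin t * (rho * sin t * 1)) with (rho * rho *
    (Rsqr (sin t) + Rsqr (cos t))) by (unfold Rsqr; ring).
  rewrite sin2_cos2, Rmult_1_r. apply sqrt_square. lra.
Qed.

Lemma circle_period (z0 : C) (rho : R) : circle z0 rho (2 * PI) = circle z0 rho 0.
Proof. unfold circle. now rewrite cos_2PI, sin_2PI, cos_0, sin_0. Qed.

Lemma continuous_on_circle (f : C -> C) (z0 : C) (rho t : R) :
  Ccont f (circle z0 rho t) ->
  @continuous R_UniformSpace C_UniformSpace (fun s => circle' rho s * f (circle z0 rho s))%C t.
Proof.
  intros Hf. apply continuous_Cmult; [apply continuous_circle'|].
  apply (@continuous_comp R_UniformSpace C_UniformSpace C_UniformSpace (circle z0 rho) f);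
    [|exact Hf].
  apply (@ex_derive_continuous R_AbsRing C_R_NormedModule).
  eexists; apply is_derive_circle.
Qed.

Lemma circle_int_primitive (F f : C -> C) (z0 : C) (rho : R) :
  (forall t, is_Cderive F (circle z0 rho t) (f (circle z0 rho t))) ->
  (forall t, Ccont f (circle z0 rho t)) ->
  CInt (fun t => circle' rho t * f (circle z0 rho t))%C 0 (2 * PI) = 0.
Proof.
  intros HF Hf.
  rewrite (CInt_derive (fun t => F (circle z0 rho t))).
  - rewrite circle_period. ring.
  - intros t _. apply is_derive_Cderive_comp; [apply HF | apply is_derive_circle].
  - intros t _. apply continuous_on_circle, Hf.
Qed.

(** To be read with p = 1 / (zeta - v), q = 1 / (zeta - w) and h = v - w, for which p - q = h p q:
    the k-th power of the Cauchy kernel, expanded to first order in w, with an error uniform in zeta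
    on the circle. *)
Lemma Cpow_kernel_bound (M : R) (k : nat) :
  0 <= M ->
  exists K, 0 <= K /\ forall p q h : C,
    (p - q = h * p * q)%C -> Cmod p <= M -> Cmod q <= M ->
    Cmod (p ^ k - q ^ k - RtoC (INR k) * h * q ^ S k) <= K * Cmod h ^ 2.
Proof.
  intros HM. induction k as [|k (K & HK & IH)].
  - exists 0. split; [lra|]. intros p q h _ _ _. simpl.
    match goal with |- Cmod ?e <= _ => replace e with (RtoC 0) by ring end.
    rewrite Cmod_0. lra.
  - exists (M * K + INR (S k) * M * M ^ S (S k)).
    assert (HS := pos_INR (S k)).
    assert (HMk : 0 <= M ^ S (S k)) by (apply pow_le; exact HM).
    assert (HMK : 0 <= M * K) by (apply Rmult_le_pos; assumption).
    assert (HSM : 0 <= INR (S k) * M) by (apply Rmult_le_pos; assumption).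
    split; [apply Rplus_le_le_0_compat; [|apply Rmult_le_pos]; assumption|].
    intros p q h Hpq Hp Hq.
    replace (p ^ S k - q ^ S k - RtoC (INR (S k)) * h * q ^ S (S k))%C with
      (p * (p ^ k - q ^ k - RtoC (INR k) * h * q ^ S k) + RtoC (INR (S k)) * p * q ^ S (S k) *
        h ^ 2)%C.
    + eapply Rle_trans; [apply Cmod_triangle|].
      rewrite !Cmod_mult, !Cmod_pow, Cmod_R, (Rabs_pos_eq _ HS), Rmult_plus_distr_r.
      specialize (IH p q h Hpq Hp Hq).
      apply Rplus_le_compat.
      * rewrite Rmult_assoc. apply Rmult_le_compat; trivial; apply Cmod_ge_0.
      * apply Rmult_le_compat_r; [apply pow2_ge_0|].
        apply Rmult_le_compat; [|apply pow_le, Cmod_ge_0 | |].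
        -- apply Rmult_le_pos; [trivial|apply Cmod_ge_0].
        -- apply Rmult_le_compat_l; trivial.
        -- apply pow_incr. split; [apply Cmod_ge_0|trivial].
    + rewrite S_INR, RtoC_plus, !Cpow_S. simpl (h ^ 0)%C.
      (* The two sides agree only modulo p - q = h p q, so their difference is displayed as a
         multiple of p - q - h p q. *)
      transitivity (p * p ^ k - q * q ^ k - (RtoC (INR k) + 1) * h * (q * (q * q ^ k))
        - (p - q - h * p * q) * q ^ k * (1 + (RtoC (INR k) + 1) * h * q))%C; [ring|].
      rewrite Hpq. ring.
Qed.

Lemma circle_minus_ge (z0 w : C) (rho t : R) :
  0 < rho -> rho - Cmod (w - z0) <= Cmod (circle z0 rho t - w).
Proof.
  intros Hr. assert (G := Cmod_minus_ge (circle z0 rho t - z0) (w - z0)).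
  rewrite Cmod_circle in G by trivial.
  replace (circle z0 rho t - z0 - (w - z0))%C with (circle z0 rho t - w)%C in G by ring.
  exact G.
Qed.

Lemma circle_neq (z0 w : C) (rho t : R) :
  0 < rho -> Cmod (w - z0) < rho -> circle z0 rho t <> w.
Proof.
  intros Hr Hw E. assert (G := circle_minus_ge z0 w rho t Hr). rewrite E in G.
  replace (w - w)%C with (RtoC 0) in G by ring. rewrite Cmod_0 in G. lra.
Qed.

(** [phi] absorbs the density and dzeta: with phi = circle' F and k = 1 this is the contour integral
    of F(zeta) / (zeta - w). Admitting all k closes the family under differentiation in w. *)
Definition cauchy_int (phi : R -> C) (z0 : C) (rho : R) (k : nat) (w : C) : C :=
  CInt (fun t => phi t * (/ (circle z0 rho t - w)) ^ k)%C 0 (2 * PI).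

Lemma continuous_cauchy_kernel (phi : R -> C) (z0 : C) (rho : R) (k : nat) (w : C) (t : R) :
  0 < rho -> Cmod (w - z0) < rho ->
  @continuous R_UniformSpace C_UniformSpace phi t ->
  @continuous R_UniformSpace C_UniformSpace
    (fun t => phi t * (/ (circle z0 rho t - w)) ^ k)%C t.
Proof.
  intros Hr Hw Hphi. apply continuous_Cmult; [exact Hphi|].
  induction k as [|k IH]; simpl.
  - apply (@continuous_const R_UniformSpace C_UniformSpace).
  - apply continuous_Cmult; [|exact IH].
    apply (@continuous_comp R_UniformSpace C_UniformSpace C_UniformSpace
      (circle z0 rho) (fun z => / (z - w))%C).
    + apply (@ex_derive_continuous R_AbsRing C_R_NormedModule).
      eexists; apply is_derive_circle.
    + eapply is_Cderive_continuous, is_Cderive_inv_shift.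
      now apply circle_neq.
Qed.

(** Differentiation under the integral sign: the second-order error of the kernel is uniform on the
    circle, so it survives integration against the bounded [phi]. *)
Lemma is_Cderive_cauchy_int (phi : R -> C) (z0 : C) (rho : R) (k : nat) (w : C) :
  0 < rho -> Cmod (w - z0) < rho ->
  (forall t, @continuous R_UniformSpace C_UniformSpace phi t) ->
  is_Cderive (cauchy_int phi z0 rho k) w
    (RtoC (INR k) * cauchy_int phi z0 rho (S k) w)%C.
Proof.
  intros Hr Hw Hphi.
  assert (H2PI : 0 <= 2 * PI) by (assert (G := PI_RGT_0); lra).
  destruct (@bounded_continuity R_AbsRing C_R_NormedModule phi 0 (2 * PI)) as [M HM].
  { intros t _. apply Hphi. }
  (* Half the distance from w to the circle: every v within m of w still has distance at least m
     from the circle, so both kernels are bounded by 1 / m. *)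
  set (m := (rho - Cmod (w - z0)) / 2).
  assert (Hm : 0 < m) by (unfold m; lra).
  destruct (Cpow_kernel_bound (/ m) k) as (K & HK & HKb).
  { apply Rlt_le, Rinv_0_lt_compat, Hm. }
  apply is_Cderive_quadratic_error with (K := (2 * PI - 0) * (M * K)) (delta := mkposreal _ Hm).
  simpl. intros v Hv.
  assert (Hv' : Cmod (v - z0) < rho).
  { replace (v - z0)%C with ((v - w) + (w - z0))%C by ring.
    eapply Rle_lt_trans; [apply Cmod_triangle|]. unfold m in Hv. lra. }
  change (Cmod (v - w) * (Cmod (v - w) * 1)) with (Cmod (v - w) ^ 2).
  assert (Hc : forall j u, Cmod (u - z0) < rho ->
    continuous_between (fun t => phi t * (/ (circle z0 rho t - u)) ^ j)%C 0 (2 * PI)).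
  { intros j u Hu t _. now apply continuous_cauchy_kernel. }
  assert (E : (cauchy_int phi z0 rho k v - cauchy_int phi z0 rho k w -
     (v - w) * (RtoC (INR k) * cauchy_int phi z0 rho (S k) w))%C =
     CInt (fun t => phi t * ((/ (circle z0 rho t - v)) ^ k - (/ (circle z0 rho t - w)) ^ k
        - RtoC (INR k) * (v - w) * (/ (circle z0 rho t - w)) ^ S k))%C 0 (2 * PI)).
  { unfold cauchy_int.
    rewrite <- CInt_minus by (now apply Hc).
    rewrite Cmult_assoc.
    rewrite <- CInt_mult by (now apply Hc).
    rewrite <- CInt_minus.
    - apply CInt_ext. intros t _. ring.
    - intros t Ht. apply (@continuous_minus R_UniformSpace R_AbsRing C_R_NormedModule);
        revert t Ht; now apply Hc.
    - intros t Ht. apply continuous_Cmult;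
        [apply (@continuous_const R_UniformSpace C_UniformSpace)|].
      revert t Ht; now apply Hc. }
  rewrite E.
  replace ((2 * PI - 0) * (M * K) * Cmod (v - w) ^ 2) with ((2 * PI - 0) * (M * (K * Cmod (v - w)
    ^ 2))) by ring.
  apply Cmod_CInt_le; trivial.
  - intros t _. apply continuous_Cmult; [apply Hphi|].
    assert (G : forall j u, Cmod (u - z0) < rho -> @continuous R_UniformSpace C_UniformSpace
      (fun t => (/ (circle z0 rho t - u)) ^ j)%C t).
    { intros j u Hu.
      apply (@continuous_ext R_UniformSpace C_UniformSpace (fun t => 1 *
        (/ (circle z0 rho t - u)) ^ j)%C).
      intros s; apply Cmult_1_l.
      apply continuous_cauchy_kernel; trivial.
      apply (@continuous_const R_UniformSpace C_UniformSpace). }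
    apply (@continuous_minus R_UniformSpace R_AbsRing C_R_NormedModule).
    + apply (@continuous_minus R_UniformSpace R_AbsRing C_R_NormedModule); now apply G.
    + apply continuous_Cmult; [apply (@continuous_const R_UniformSpace C_UniformSpace)|].
      now apply G.
  - intros t Ht. rewrite Cmod_mult.
    specialize (HM t Ht). rewrite norm_C_R in HM.
    assert (Gw : m <= Cmod (circle z0 rho t - w)).
    { assert (G := circle_minus_ge z0 w rho t Hr). unfold m in *; lra. }
    assert (Gv : m <= Cmod (circle z0 rho t - v)).
    { assert (G := circle_minus_ge z0 v rho t Hr).
      assert (G' := Cmod_triangle (v - w) (w - z0)).
      replace (v - w + (w - z0))%C with (v - z0)%C in G' by ring. unfold m in *; lra. }
    assert (Nw : (circle z0 rho t - w)%C <> 0) by (apply C_neq_of_Cmod; lra).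
    assert (Nv : (circle z0 rho t - v)%C <> 0) by (apply C_neq_of_Cmod; lra).
    apply Rmult_le_compat; try apply Cmod_ge_0; [lra|].
    apply HKb.
    + field. auto.
    + rewrite Cmod_inv by trivial. apply Rinv_le_contravar; lra.
    + rewrite Cmod_inv by trivial. apply Rinv_le_contravar; lra.
Qed.

Lemma circle'_circle (z0 : C) (rho t : R) :
  circle' rho t = (Ci * (circle z0 rho t - z0))%C.
Proof. apply C_eq; unfold circle, circle'; simpl; ring. Qed.

(** At the centre the integrand is the constant i. The derivative in w is the integral of 1 / (zeta
    - w)^2, which has the primitive -1 / (zeta - w) along the circle and so vanishes; hence the
    value is the same on the whole disc. *)
Lemma winding_integral (z0 : C) (rho : R) (w : C) :
  0 < rho -> Cmod (w - z0) < rho ->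
  cauchy_int (circle' rho) z0 rho 1 w = (RtoC (2 * PI) * Ci)%C.
Proof.
  intros Hr Hw.
  assert (E0 : cauchy_int (circle' rho) z0 rho 1 z0 = (RtoC (2 * PI) * Ci)%C).
  { rewrite <- (Rminus_0_r (2 * PI)). rewrite <- CInt_const.
    apply CInt_ext. intros t _. rewrite (circle'_circle z0).
    assert (N : (circle z0 rho t - z0)%C <> 0).
    { apply C_neq_of_Cmod. now rewrite Cmod_circle. }
    simpl. field. exact N. }
  rewrite <- E0.
  assert (Hd : forall v, Cmod (v - z0) < rho ->
    is_Cderive (cauchy_int (circle' rho) z0 rho 1) v 0).
  { intros v Hv.
    assert (Hne : forall t, circle z0 rho t <> v).
    { intros t. now apply circle_neq. }
    replace (RtoC 0) with (RtoC (INR 1) * cauchy_int (circle' rho) z0 rho 2 v)%C.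
    - apply is_Cderive_cauchy_int; trivial. intros t; apply continuous_circle'.
    - replace (cauchy_int (circle' rho) z0 rho 2 v) with (RtoC 0); [ring|].
      symmetry. unfold cauchy_int.
      rewrite (CInt_ext _ (fun t => circle' rho t * (fun z => - - (/ (z - v) *
        / (z - v)))%C (circle z0 rho t))%C)
        by (intros t _; simpl; ring).
      apply (circle_int_primitive (fun z => 0 - / (z - v))%C (fun z => - - (/ (z - v) *
        / (z - v)))%C).
      + intros t. replace (- - (/ (circle z0 rho t - v) * / (circle z0 rho t - v)))%C
          with (0 - - / (circle z0 rho t - v) ^ 2)%C.
        * apply is_Cderive_minus; [apply is_Cderive_const|]. now apply is_Cderive_inv_shift.
        * assert (N := Cminus_eq_contra _ _ (Hne t)). simpl. field. exact N.
      + intros t.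
        apply (@continuous_ext C_UniformSpace C_UniformSpace (fun z => / (z - v) * / (z - v))%C).
        { intros z. match goal with |- ?a = ?b => change (@eq C a b) end. ring. }
        eapply is_Cderive_continuous. apply (is_Cderive_mult (fun z => / (z - v))
          (fun z => / (z - v)))%C;
        now apply is_Cderive_inv_shift. }
  assert (G := Cmod_increment_le (cauchy_int (circle' rho) z0 rho 1) (fun _ => 0) z0 w 0).
  rewrite Rmult_0_r, Rmult_0_l in G.
  apply Ceq_minus, Cmod_eq_0, Rle_antisym; [apply G|apply Cmod_ge_0].
  intros v Hv. split; [apply Hd; lra|]. rewrite Cmod_0. lra.
Qed.

Lemma in_square_circle (z0 : C) (rho r t : R) :
  0 < rho < r -> in_square z0 r (circle z0 rho t).
Proof.
  intros Hr. assert (G := Cmod_circle z0 rho t (proj1 Hr)).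
  assert (G1 := fst_le_Cmod (circle z0 rho t - z0)). assert (G2 :=
    snd_le_Cmod (circle z0 rho t - z0)).
  rewrite G in G1, G2.
  split; (eapply Rle_lt_trans; [|apply Hr]); assumption.
Qed.

Lemma cauchy_formula (F f : C -> C) (z0 : C) (r rho : R) (w : C) :
  0 < rho < r ->
  (forall z, in_square z0 r z -> is_Cderive F z (f z)) ->
  (forall z, in_square z0 r z -> exists l, is_Cderive f z l) ->
  Cmod (w - z0) < rho ->
  (cauchy_int (fun t => circle' rho t * F (circle z0 rho t)) z0 rho 1 w
    = RtoC (2 * PI) * Ci * F w)%C.
Proof.
  intros Hr HF Hf Hw. assert (Hr0 := proj1 Hr).
  assert (Hwsq : in_square z0 r w).
  { assert (G1 := fst_le_Cmod (w - z0)). assert (G2 := snd_le_Cmod (w - z0)).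
    simpl in G1, G2. split; lra || (eapply Rle_lt_trans; [eassumption|lra]). }
  assert (Hne : forall t, circle z0 rho t <> w).
  { intros t. now apply circle_neq. }
  assert (HFc : forall t, @continuous R_UniformSpace C_UniformSpace (fun t => circle' rho t *
    F (circle z0 rho t))%C t).
  { intros t. eapply continuous_on_circle, is_Cderive_continuous, HF, in_square_circle, Hr. }
  assert (Hq := is_Cderive_difference_quotient F f z0 w r HF Hf Hwsq).
  set (h := fun z => if Ceq_dec z w then f w else ((F z - F w) / (z - w))%C) in Hq.
  destruct (primitive_on_square h z0 r Hq) as [P HP].
  assert (E : CInt (fun t => circle' rho t * h (circle z0 rho t))%C 0 (2 * PI) = 0).
  { apply circle_int_primitive with P.
    - intros t. apply HP, in_square_circle, Hr.
    - intros t. destruct (Hq (circle z0 rho t)) as [l Hl]; [apply in_square_circle, Hr|].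
      eapply is_Cderive_continuous, Hl. }
  (* Writing 2 pi i as the integral of 1 / (zeta - w) turns the difference of the two sides into the
     vanishing integral of [h]. *)
  rewrite <- (winding_integral z0 rho w Hr0 Hw), Cmult_comm.
  apply Ceq_minus. rewrite <- E. unfold cauchy_int.
  rewrite <- CInt_mult, <- CInt_minus.
  - apply CInt_ext. intros t _. unfold h.
    destruct (Ceq_dec (circle z0 rho t) w) as [Et|_]; [now destruct (Hne t)|].
    simpl. field. apply Cminus_eq_contra, Hne.
  - intros t _. now apply continuous_cauchy_kernel.
  - intros t _. apply continuous_Cmult;
      [apply (@continuous_const R_UniformSpace C_UniformSpace)|].
    apply continuous_cauchy_kernel; trivial. apply continuous_circle'.
  - intros t _. apply continuous_cauchy_kernel; trivial. apply continuous_circle'.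
Qed.

(** The differentiability of f1 is part of the conclusion so that the theorem can be applied again
    to f1. With F a primitive of f and I_k its Cauchy integrals, 2 pi i F = I_1, and differentiating
    gives 2 pi i f = I_2 and 2 pi i f1 = 2 I_3. *)
Theorem holomorphic_derivative (f : C -> C) (z0 : C) (r : posreal) :
  (forall z, Cmod (z - z0) < r -> exists l, is_Cderive f z l) ->
  exists (f1 : C -> C) (rho : posreal), forall z, Cmod (z - z0) < rho ->
    is_Cderive f z (f1 z) /\ exists l, is_Cderive f1 z l.
Proof.
  intros Hf.
  assert (Hr := cond_pos r).
  (* As |z| is at most |x| + |y|, half-side r / 2 keeps the square inside the disc; the circle of
     radius r / 4 then lies inside the square. *)
  assert (Hsq : forall z, in_square z0 (r / 2) z -> exists l, is_Cderive f z l).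
  { intros z [H1 H2]. apply Hf. eapply Rle_lt_trans; [apply Cmod_le_sum|].
    simpl. unfold Rminus in *. lra. }
  destruct (primitive_on_square f z0 (r / 2) Hsq) as [F HF].
  set (rho := r / 4). assert (Hrho : 0 < rho < r / 2) by (unfold rho; lra).
  set (phi := fun t => (circle' rho t * F (circle z0 rho t))%C).
  assert (HFc : forall t, @continuous R_UniformSpace C_UniformSpace phi t).
  { intros t. eapply continuous_on_circle, is_Cderive_continuous, HF, in_square_circle, Hrho. }
  set (c := (RtoC (2 * PI) * Ci)%C).
  assert (Hc : c <> 0).
  { apply Cmult_neq_0; [|apply Ci_nz]. intros E. apply RtoC_inj in E. assert (G := PI_RGT_0).
    lra. }
  assert (HN : forall k z, Cmod (z - z0) < rho ->
     is_Cderive (fun z => / c * cauchy_int phi z0 rho k z)%C z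
      (/ c * (RtoC (INR k) * cauchy_int phi z0 rho (S k) z))%C).
  { intros k z Hz.
    replace (/ c * (RtoC (INR k) * cauchy_int phi z0 rho (S k) z))%C with
      (0 * cauchy_int phi z0 rho k z + / c * (RtoC (INR k) * cauchy_int phi z0 rho (S k) z))%C by
        ring.
    apply (is_Cderive_mult (fun _ => / c)%C); [apply is_Cderive_const|].
    now apply is_Cderive_cauchy_int. }
  assert (Hopen : forall z, Cmod (z - z0) < rho -> exists delta : posreal,
    forall w, Cmod (w - z) < delta -> Cmod (w - z0) < rho).
  { intros z Hz. assert (Hd : 0 < rho - Cmod (z - z0)) by lra.
    exists (mkposreal _ Hd). simpl. intros w Hw.
    replace (w - z0)%C with ((w - z) + (z - z0))%C by ring.
    eapply Rle_lt_trans; [apply Cmod_triangle|]. lra. }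
  (* Both sides are derivatives of F at z, the right one through Cauchy's formula. *)
  assert (Ef : forall z, Cmod (z - z0) < rho -> f z = (/ c * cauchy_int phi z0 rho 2 z)%C).
  { intros z Hz. apply (is_Cderive_unique F z).
    - apply HF. assert (G1 := fst_le_Cmod (z - z0)). assert (G2 := snd_le_Cmod (z - z0)).
      split; (eapply Rle_lt_trans; [eassumption|lra]).
    - destruct (Hopen z Hz) as [delta Hdelta].
      apply is_Cderive_ext_loc with (fun z => / c * cauchy_int phi z0 rho 1 z)%C delta.
      + intros w Hw. unfold phi.
        rewrite (cauchy_formula F f z0 (r / 2) rho w); auto.
        fold c. field. exact Hc.
      + replace (cauchy_int phi z0 rho 2 z) with (RtoC (INR 1) * cauchy_int phi z0 rho 2 z)%C by
          (simpl; ring).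
        now apply HN. }
  exists (fun z => / c * (RtoC (INR 2) * cauchy_int phi z0 rho 3 z))%C,
    (mkposreal _ (proj1 Hrho)).
  simpl pos. intros z Hz. split.
  - destruct (Hopen z Hz) as [delta Hdelta].
    apply is_Cderive_ext_loc with (fun z => / c * cauchy_int phi z0 rho 2 z)%C delta.
    + intros w Hw. symmetry. apply Ef. auto.
    + now apply HN.
  - eexists. apply (is_Cderive_mult (fun _ => / c)%C); [apply is_Cderive_const|].
    apply (is_Cderive_mult (fun _ => RtoC (INR 2))%C); [apply is_Cderive_const|].
    now apply is_Cderive_cauchy_int.
Qed.

(** * The 2-jet of a conformal change *)

Lemma Derive_eq (g : R -> R) (t l : R) : is_derive g t l -> Derive (fun s : R => g s) t = l.
Proof. apply is_derive_unique. Qed.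

(** Continuity of the partial derivatives gives a total differential, which a chain rule along an
    arbitrary curve requires. *)
Lemma is_derive_comp_C1 (u : R * R -> R) (gamma : R -> C) (t : R) (k : C) :
  is_C1 u ->
  @is_derive R_AbsRing C_R_NormedModule gamma t k ->
  is_derive (fun s => u (gamma s)) t
    (fst k * D1 u (gamma t) + snd k * D2 u (gamma t)).
Proof.
  intros Hu Hg.
  apply (is_derive_comp_filterdiff R_NormedModule u
    (fun y => fst y * D1 u (gamma t) + snd y * D2 u (gamma t)) gamma t k); trivial.
  destruct (gamma t) as [x y].
  apply filterdiff_ext with (fun p => u (fst p, snd p)).
  { intros [a b]. reflexivity. }
  apply (is_derive_filterdiff (fun a b => u (a, b)) x y (fun a b => D1 u (a, b))).
  - apply filter_forall. intros [a b]. apply Derive_correct, (Hu (a, b)).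
  - apply Derive_correct, (Hu (x, y)).
  - apply (continuous_ext (D1 u)). intros [a b]; reflexivity. apply (Hu (x, y)).
Qed.

(* With U the gradient of u at f z, k f'(z) = (A, B) and k^2 f''(z) = (A', B'), this is the
   derivative of the conformal change of u by f at z in the unit direction k. *)
Definition dir_deriv (A B A' B' U1 U2 : R) : R :=
  A * U1 + B * U2 + 2 * (A * A' + B * B') / (A ^ 2 + B ^ 2).

Definition dir_deriv' (A B A' B' U1 U2 dA dB dA' dB' dU1 dU2 : R) : R :=
  dA * U1 + A * dU1 + dB * U2 + B * dU2 +
  2 * ((dA * A' + A * dA' + dB * B' + B * dB') / (A ^ 2 + B ^ 2)
       - (A * A' + B * B') * (2 * A * dA + 2 * B * dB) / (A ^ 2 + B ^ 2) ^ 2).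

Lemma is_derive_dir_deriv (A B A' B' U1 U2 : R -> R) (t dA dB dA' dB' dU1 dU2 : R) :
  is_derive A t dA -> is_derive B t dB -> is_derive A' t dA' -> is_derive B' t dB' ->
  is_derive U1 t dU1 -> is_derive U2 t dU2 ->
  A t ^ 2 + B t ^ 2 <> 0 ->
  is_derive (fun s => dir_deriv (A s) (B s) (A' s) (B' s) (U1 s) (U2 s)) t
    (dir_deriv' (A t) (B t) (A' t) (B' t) (U1 t) (U2 t) dA dB dA' dB' dU1 dU2).
Proof.
  intros HA HB HA' HB' HU1 HU2 Hnz. unfold dir_deriv, dir_deriv'.
  auto_derive.
  - repeat split; trivial; try (eexists; eassumption).
  - rewrite (Derive_eq A _ _ HA), (Derive_eq B _ _ HB), (Derive_eq A' _ _ HA'),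
      (Derive_eq B' _ _ HB'), (Derive_eq U1 _ _ HU1), (Derive_eq U2 _ _ HU2).
    field. exact Hnz.
Qed.

Lemma is_derive_plus_ln_sum_squares (U A B : R -> R) (t dU dA dB : R) :
  is_derive U t dU -> is_derive A t dA -> is_derive B t dB ->
  A t ^ 2 + B t ^ 2 <> 0 ->
  is_derive (fun s => U s + ln (A s ^ 2 + B s ^ 2)) t
    (dU + 2 * (A t * dA + B t * dB) / (A t ^ 2 + B t ^ 2)).
Proof.
  intros HU HA HB Hnz.
  auto_derive.
  - repeat split; try (eexists; eassumption). nra.
  - rewrite (Derive_eq A _ _ HA), (Derive_eq B _ _ HB), (Derive_eq U _ _ HU).
    field. exact Hnz.
Qed.

Lemma sum_squares_neq_0 (z : C) : z <> 0 -> fst z ^ 2 + snd z ^ 2 <> 0.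
Proof.
  intros Hz E. apply Hz. destruct z as [a b]. simpl in E. apply C_eq; simpl; nra.
Qed.

Lemma is_derive_mult_Cderive (f : C -> C) (gamma : R -> C) (t : R) (m l k : C) :
  is_Cderive f (gamma t) l ->
  @is_derive R_AbsRing C_R_NormedModule gamma t k ->
  @is_derive R_AbsRing C_R_NormedModule (fun s => m * f (gamma s))%C t (k * (m * l))%C.
Proof.
  intros Hf Hg.
  apply (is_derive_Cderive_comp (fun z => m * f z)%C); trivial.
  replace (m * l)%C with (0 * f (gamma t) + m * l)%C by ring.
  apply (is_Cderive_mult (fun _ => m)); trivial. apply is_Cderive_const.
Qed.

(** The Cauchy-Riemann equations: the partial derivatives of f are l and i l. *)
Lemma jacobian_holomorphic (f : C -> C) (z l : C) :
  is_Cderive f z l -> jacobian f z = fst l ^ 2 + snd l ^ 2.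
Proof.
  intros Hf. destruct z as [x y].
  assert (H1 := is_derive_Cderive_comp f (fun t => (t, y)) x l _ Hf (is_derive_horizontal y x)).
  assert (H2 := is_derive_Cderive_comp f (fun t => (x, t)) y l _ Hf (is_derive_vertical x y)).
  unfold jacobian, D1, D2. cbn [fst snd].
  rewrite (Derive_eq (fun t : R => fst (f (t, y))) _ _ (is_derive_fst _ _ _ H1)),
    (Derive_eq (fun t : R => snd (f (t, y))) _ _ (is_derive_snd _ _ _ H1)),
    (Derive_eq (fun t : R => fst (f (x, t))) _ _ (is_derive_fst _ _ _ H2)),
    (Derive_eq (fun t : R => snd (f (x, t))) _ _ (is_derive_snd _ _ _ H2)).
  simpl. ring.
Qed.

Section Jet.

Variables (u : R * R -> R) (f f1 f2 : C -> C) (z0 f3 : C) (rho : posreal).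
Hypothesis Hu : is_C2 u.
Hypothesis Hf : forall z, Cmod (z - z0) < rho -> is_Cderive f z (f1 z).
Hypothesis Hf1 : forall z, Cmod (z - z0) < rho -> is_Cderive f1 z (f2 z).
Hypothesis Hf2 : is_Cderive f2 z0 f3.
Hypothesis Hnz : forall z, Cmod (z - z0) < rho -> f1 z <> 0.

Let v := conformal_change u f.

(** Since |k f'| = |f'| for a unit k, one formula covers both partial derivatives: k = 1 gives [D1]
    and k = i gives [D2]. *)
Definition dir_field (k z : C) : R :=
  dir_deriv (fst (k * f1 z)%C) (snd (k * f1 z)%C) (fst (k * k * f2 z)%C) (snd (k * k * f2 z)%C)
    (D1 u (f z)) (D2 u (f z)).

(** Moving through z0 with velocity m changes k f' at the rate m k f'', k^2 f'' at the rate m k^2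
    f''', and the gradient of u at f by the second derivatives of u applied to m f'. This is the
    second derivative of the conformal change, first in direction k, then in direction m. *)
Definition dir_field' (m k : C) : R :=
  dir_deriv' (fst (k * f1 z0)%C) (snd (k * f1 z0)%C) (fst (k * k * f2 z0)%C) (snd (k * k *
    f2 z0)%C)
    (D1 u (f z0)) (D2 u (f z0))
    (fst (m * (k * f2 z0))%C) (snd (m * (k * f2 z0))%C)
    (fst (m * (k * k * f3))%C) (snd (m * (k * k * f3))%C)
    (fst (m * f1 z0)%C * D1 (D1 u) (f z0) + snd (m * f1 z0)%C * D2 (D1 u) (f z0))
    (fst (m * f1 z0)%C * D1 (D2 u) (f z0) + snd (m * f1 z0)%C * D2 (D2 u) (f z0)).

Lemma disc_open (z : C) :
  Cmod (z - z0) < rho -> @locally C_UniformSpace z (fun w => Cmod (w - z0) < rho).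
Proof.
  intros Hz. apply (proj2 (locally_Cmod z _)).
  assert (Hd : 0 < rho - Cmod (z - z0)) by lra.
  exists (mkposreal _ Hd). simpl. intros w Hw.
  replace (w - z0)%C with ((w - z) + (z - z0))%C by ring.
  eapply Rle_lt_trans; [apply Cmod_triangle|]. lra.
Qed.

Lemma conformal_change_eq (z : C) :
  Cmod (z - z0) < rho -> v z = u (f z) + ln (fst (f1 z) ^ 2 + snd (f1 z) ^ 2).
Proof.
  intros Hz. unfold v, conformal_change.
  rewrite (jacobian_holomorphic f z (f1 z)) by auto.
  rewrite Rabs_pos_eq; [reflexivity|nra].
Qed.

Lemma is_derive_conformal_change (gamma : R -> C) (t : R) (k : C) :
  Cmod (gamma t - z0) < rho -> fst k ^ 2 + snd k ^ 2 = 1 ->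
  @is_derive R_AbsRing C_R_NormedModule gamma t k ->
  is_derive (fun s => v (gamma s)) t (dir_field k (gamma t)).
Proof.
  intros Hz Hk Hg.
  assert (Hc : @continuous R_UniformSpace C_UniformSpace gamma t).
  { apply (@ex_derive_continuous R_AbsRing C_R_NormedModule). now exists k. }
  apply is_derive_ext_loc with
    (fun s => u (f (gamma s)) + ln (fst (f1 (gamma s)) ^ 2 + snd (f1 (gamma s)) ^ 2)).
  { apply (filter_imp (fun s => Cmod (gamma s - z0) < rho)).
    - intros s Hs. symmetry. now apply conformal_change_eq.
    - exact (Hc _ (disc_open _ Hz)). }
  assert (G0 := is_derive_comp_C1 u (fun s => f (gamma s)) t _ (proj1 Hu)
    (is_derive_Cderive_comp f gamma t _ _ (Hf _ Hz) Hg)).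
  assert (G1 := is_derive_Cderive_comp f1 gamma t _ _ (Hf1 _ Hz) Hg).
  assert (Ga := is_derive_fst _ _ _ G1). assert (Gb := is_derive_snd _ _ _ G1).
  assert (Hn := sum_squares_neq_0 _ (Hnz _ Hz)).
  assert (G := is_derive_plus_ln_sum_squares (fun s => u (f (gamma s)))
    (fun s => fst (f1 (gamma s)))
    (fun s => snd (f1 (gamma s))) t _ _ _ G0 Ga Gb Hn).
  match type of G with is_derive _ _ ?l => replace (dir_field k (gamma t)) with l; [exact G|] end.
    unfold dir_field, dir_deriv.
    (* Multiplication by the unit k is a rotation and preserves the inner products in the derivative
       of ln|f'|^2. *)
    assert (E1 : fst (k * f1 (gamma t))%C ^ 2 + snd (k * f1 (gamma t))%C ^ 2
      = fst (f1 (gamma t)) ^ 2 + snd (f1 (gamma t)) ^ 2).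
    { transitivity ((fst k ^ 2 + snd k ^ 2) * (fst (f1 (gamma t)) ^ 2 + snd (f1 (gamma t)) ^ 2)).
      simpl; ring. rewrite Hk. ring. }
    assert (E2 : fst (k * f1 (gamma t))%C * fst (k * k * f2 (gamma t))%C + snd (k *
      f1 (gamma t))%C * snd (k * k * f2 (gamma t))%C
       = fst (f1 (gamma t)) * fst (k * f2 (gamma t))%C + snd (f1 (gamma t)) * snd (k *
         f2 (gamma t))%C).
    { transitivity ((fst k ^ 2 + snd k ^ 2) * (fst (f1 (gamma t)) * fst (k * f2 (gamma t))%C +
        snd (f1 (gamma t)) * snd (k * f2 (gamma t))%C)).
      simpl; ring. rewrite Hk. ring. }
    rewrite E1, E2. simpl. field. intros E. apply Hn. rewrite <- E. ring.
Qed.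

Lemma is_derive_dir_field (gamma : R -> C) (t : R) (m k : C) :
  gamma t = z0 -> fst k ^ 2 + snd k ^ 2 = 1 ->
  @is_derive R_AbsRing C_R_NormedModule gamma t m ->
  is_derive (fun s => dir_field k (gamma s)) t (dir_field' m k).
Proof.
  intros Et Hk Hg.
  assert (Hz : Cmod (gamma t - z0) < rho).
  { rewrite Et. replace (z0 - z0)%C with (RtoC 0) by ring. rewrite Cmod_0. apply cond_pos. }
  assert (Hf2' : is_Cderive f2 (gamma t) f3) by (now rewrite Et).
  assert (G0 := is_derive_Cderive_comp f gamma t _ _ (Hf _ Hz) Hg).
  assert (G1 := is_derive_mult_Cderive f1 gamma t k _ _ (Hf1 _ Hz) Hg).
  assert (G2 := is_derive_mult_Cderive f2 gamma t (k * k)%C _ _ Hf2' Hg).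
  assert (GU1 := is_derive_comp_C1 (D1 u) (fun s => f (gamma s)) t _ (proj1 (proj2 Hu)) G0).
  assert (GU2 := is_derive_comp_C1 (D2 u) (fun s => f (gamma s)) t _ (proj2 (proj2 Hu)) G0).
  assert (R := is_derive_dir_deriv _ _ _ _ _ _ t _ _ _ _ _ _
    (is_derive_fst _ _ _ G1) (is_derive_snd _ _ _ G1) (is_derive_fst _ _ _ G2)
      (is_derive_snd _ _ _ G2) GU1 GU2).
  cbv beta in R. rewrite Et in R. apply R.
  apply sum_squares_neq_0, Cmult_neq_0.
  - intros ->. simpl in Hk. lra.
  - apply Hnz. rewrite <- Et at 1. exact Hz.
Qed.

Lemma unit_1 : fst (RtoC 1) ^ 2 + snd (RtoC 1) ^ 2 = 1.
Proof. simpl; ring. Qed.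

Lemma unit_Ci : fst Ci ^ 2 + snd Ci ^ 2 = 1.
Proof. simpl; ring. Qed.

Lemma D1_conformal_change (z : C) : Cmod (z - z0) < rho -> D1 v z = dir_field 1 z.
Proof.
  destruct z as [x y]. intros Hz. apply is_derive_unique.
  apply (is_derive_conformal_change (fun t => (t, y)) x); trivial;
    [apply unit_1|apply is_derive_horizontal].
Qed.

Lemma D2_conformal_change (z : C) : Cmod (z - z0) < rho -> D2 v z = dir_field Ci z.
Proof.
  destruct z as [x y]. intros Hz. apply is_derive_unique.
  apply (is_derive_conformal_change (fun t => (x, t)) y); trivial;
    [apply unit_Ci|apply is_derive_vertical].
Qed.

Lemma center_in_disc : Cmod (z0 - z0) < rho.
Proof. replace (z0 - z0)%C with (RtoC 0) by ring. rewrite Cmod_0. apply cond_pos. Qed.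

(** A general g lets the same argument treat both first derivatives of the conformal change. *)
Lemma D1_of_dir_field (g : C -> R) (k : C) :
  fst k ^ 2 + snd k ^ 2 = 1 ->
  (forall z, Cmod (z - z0) < rho -> g z = dir_field k z) ->
  D1 g z0 = dir_field' 1 k.
Proof.
  intros Hk Hg. apply is_derive_unique.
  assert (Ez : (fst z0, snd z0) = z0) by (symmetry; apply surjective_pairing).
  apply is_derive_ext_loc with (fun t => dir_field k (t, snd z0)).
  - apply (filter_imp (fun s => Cmod ((s, snd z0) - z0) < rho)).
    + intros s Hs. symmetry. now apply Hg.
    + assert (Hc : @continuous R_UniformSpace C_UniformSpace (fun s => (s, snd z0)) (fst z0)).
      { apply (@ex_derive_continuous R_AbsRing C_R_NormedModule). eexists;
          apply is_derive_horizontal. }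
      apply (Hc (fun w => Cmod (w - z0) < rho)).
      (* (fst z0, snd z0) is not convertible to z0, so the neighbourhood is transported along
         [Ez]. *)
      exact (eq_ind_r (fun p => @locally C_UniformSpace p _) (disc_open z0 center_in_disc) Ez).
  - apply (is_derive_dir_field (fun t => (t, snd z0))); auto. apply is_derive_horizontal.
Qed.

Lemma D2_of_dir_field (g : C -> R) (k : C) :
  fst k ^ 2 + snd k ^ 2 = 1 ->
  (forall z, Cmod (z - z0) < rho -> g z = dir_field k z) ->
  D2 g z0 = dir_field' Ci k.
Proof.
  intros Hk Hg. apply is_derive_unique.
  assert (Ez : (fst z0, snd z0) = z0) by (symmetry; apply surjective_pairing).
  apply is_derive_ext_loc with (fun t => dir_field k (fst z0, t)).
  - apply (filter_imp (fun s => Cmod ((fst z0, s) - z0) < rho)).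
    + intros s Hs. symmetry. now apply Hg.
    + assert (Hc : @continuous R_UniformSpace C_UniformSpace (fun s => (fst z0, s)) (snd z0)).
      { apply (@ex_derive_continuous R_AbsRing C_R_NormedModule). eexists;
          apply is_derive_vertical. }
      apply (Hc (fun w => Cmod (w - z0) < rho)).
      exact (eq_ind_r (fun p => @locally C_UniformSpace p _) (disc_open z0 center_in_disc) Ez).
  - apply (is_derive_dir_field (fun t => (fst z0, t))); auto. apply is_derive_vertical.
Qed.

Lemma conformal_change_jet :
  v z0 = u (f z0) + ln (fst (f1 z0) ^ 2 + snd (f1 z0) ^ 2) /\
  D1 v z0 = dir_field 1 z0 /\ D2 v z0 = dir_field Ci z0 /\
  D1 (D1 v) z0 = dir_field' 1 1 /\ D1 (D2 v) z0 = dir_field' 1 Ci /\ D2 (D2 v) z0 =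
    dir_field' Ci Ci.
Proof.
  repeat split.
  - apply conformal_change_eq, center_in_disc.
  - apply D1_conformal_change, center_in_disc.
  - apply D2_conformal_change, center_in_disc.
  - apply D1_of_dir_field; [apply unit_1 | apply D1_conformal_change].
  - apply D1_of_dir_field; [apply unit_Ci | apply D2_conformal_change].
  - apply D2_of_dir_field; [apply unit_Ci | apply D2_conformal_change].
Qed.

End Jet.

(** * Conformal invariance *)

(** The polynomial with prescribed 2-jet at z0. With the squares halved, both partial derivatives
    are again quadrics with shifted coefficients, so all its derivatives are found by rewriting. *)
Definition quadric (z0 : R * R) (s p q a b c : R) (z : R * R) : R :=
  s + p * (fst z - fst z0) + q * (snd z - snd z0) + a / 2 * (fst z - fst z0) ^ 2
  + b * (fst z - fst z0) * (snd z - snd z0) + c / 2 * (snd z - snd z0) ^ 2.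

Lemma is_derive_quadric_1 (z0 : R * R) (s p q a b c x y : R) :
  is_derive (fun t => quadric z0 s p q a b c (t, y)) x (quadric z0 p a b 0 0 0 (x, y)).
Proof. unfold quadric; simpl. auto_derive; [trivial|field]. Qed.

Lemma is_derive_quadric_2 (z0 : R * R) (s p q a b c x y : R) :
  is_derive (fun t => quadric z0 s p q a b c (x, t)) y (quadric z0 q b c 0 0 0 (x, y)).
Proof. unfold quadric; simpl. auto_derive; [trivial|field]. Qed.

Lemma D1_quadric (z0 : R * R) (s p q a b c : R) :
  D1 (quadric z0 s p q a b c) = quadric z0 p a b 0 0 0.
Proof.
  apply functional_extensionality. intros [x y]. apply is_derive_unique, is_derive_quadric_1.
Qed.

Lemma D2_quadric (z0 : R * R) (s p q a b c : R) :
  D2 (quadric z0 s p q a b c) = quadric z0 q b c 0 0 0.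
Proof.
  apply functional_extensionality. intros [x y]. apply is_derive_unique, is_derive_quadric_2.
Qed.

Lemma continuous_quadric (z0 : R * R) (s p q a b c : R) (z : R * R) :
  continuous (quadric z0 s p q a b c) z.
Proof.
  destruct z as [x y].
  assert (H1 : continuous (fun z : R * R => fst z - fst z0) (x, y)).
  { apply (@continuous_minus _ R_AbsRing R_NormedModule);
      [apply continuous_fst | apply continuous_const]. }
  assert (H2 : continuous (fun z : R * R => snd z - snd z0) (x, y)).
  { apply (@continuous_minus _ R_AbsRing R_NormedModule);
      [apply continuous_snd | apply continuous_const]. }
  assert (Hp : forall g h : R * R -> R, continuous g (x, y) ->
    continuous h (x, y) -> continuous (fun z => g z + h z) (x, y)).
  { intros g h. apply (@continuous_plus _ R_AbsRing R_NormedModule). }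
  assert (Hm : forall g h : R * R -> R, continuous g (x, y) ->
    continuous h (x, y) -> continuous (fun z => g z * h z) (x, y)).
  { intros g h. apply (@continuous_mult _ R_AbsRing). }
  assert (Hc : forall k : R, continuous (fun _ : R * R => k) (x, y)).
  { intros k. apply continuous_const. }
  unfold quadric. simpl pow. auto 12.
Qed.

Lemma is_C1_quadric (z0 : R * R) (s p q a b c : R) : is_C1 (quadric z0 s p q a b c).
Proof.
  intros [x y]. rewrite D1_quadric, D2_quadric.
  repeat split; try apply continuous_quadric.
  - eexists. apply is_derive_quadric_1.
  - eexists. apply is_derive_quadric_2.
Qed.

Lemma is_C2_quadric (z0 : R * R) (s p q a b c : R) : is_C2 (quadric z0 s p q a b c).
Proof.
  split; [|rewrite D1_quadric, D2_quadric; split]; apply is_C1_quadric.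
Qed.

(** This makes a hypothesis on functions C^2 on the plane applicable to a conformal change, which is
    regular only near z. *)
Lemma operator_eq_quadric (H : R * R -> R -> R * R -> Sym2 -> R) (u : R * R -> R) (z : R * R) :
  operator H u z = operator H (quadric z (u z) (D1 u z) (D2 u z)
    (D1 (D1 u) z) (D1 (D2 u) z) (D2 (D2 u) z)) z.
Proof.
  unfold operator, grad, hessian.
  repeat rewrite ?D1_quadric, ?D2_quadric.
  assert (E : forall s p q a b c, quadric z s p q a b c z = s).
  { intros. unfold quadric. rewrite !Rminus_diag. ring. }
  now rewrite !E.
Qed.

Lemma neq_0_nearby (f : C -> C) (z l : C) :
  is_Cderive f z l -> f z <> 0 ->
  exists delta : posreal, forall w, Cmod (w - z) < delta -> f w <> 0.
Proof.
  intros Hf Hz. apply is_Cderive_continuous in Hf.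
  assert (Hloc : @locally C_UniformSpace (f z) (fun w : C => w <> 0)).
  { apply (proj2 (locally_Cmod _ _)). exists (mkposreal _ (proj1 (Cmod_gt_0 _) Hz)).
    simpl. intros w Hw ->. replace (0 - f z)%C with (- f z)%C in Hw by ring.
    rewrite Cmod_opp in Hw. lra. }
  exact (proj1 (locally_Cmod _ _) (Hf _ Hloc)).
Qed.

Lemma invariant_form_sufficient (H : R * R -> R -> R * R -> Sym2 -> R) (g : R -> R) :
  (forall u, is_C2 u -> forall x, operator H u x = g (- exp (- u x) * laplacian u x)) ->
  conformally_invariant H.
Proof.
  intros Hg psi u Hpsi Hu z Hpole Hzero.
  destruct (Hpsi z) as [Hhol|]; [|contradiction].
  apply (proj1 (locally_Cmod z _)) in Hhol. destruct Hhol as [r Hr].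
  (* Three derivatives of psi enter, since ln|psi'|^2 is differentiated twice. *)
  destruct (holomorphic_derivative psi z r Hr) as (f1 & r1 & H1).
  destruct (holomorphic_derivative f1 z r1) as (f2 & r2 & H2); [intros w Hw; now apply H1|].
  destruct (holomorphic_derivative f2 z r2) as (f3 & r3 & H3); [intros w Hw; now apply H2|].
  assert (Hzz : forall r : posreal, Cmod (z - z) < r).
  { intros r'. replace (z - z)%C with (RtoC 0) by ring. rewrite Cmod_0. apply cond_pos. }
  assert (Hf1z : f1 z <> 0).
  { intros E. apply Hzero. assert (G := proj1 (H1 z (Hzz r1))). rewrite E in G. exact G. }
  destruct (proj2 (H1 z (Hzz r1))) as [l Hl].
  destruct (neq_0_nearby f1 z l Hl Hf1z) as [r4 H4].
  assert (Hrho : 0 < Rmin (Rmin r1 r2) r4) by (repeat apply Rmin_pos; apply cond_pos).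
  set (rho := mkposreal _ Hrho).
  assert (L1 : rho <= r1) by (eapply Rle_trans; [apply Rmin_l|apply Rmin_l]).
  assert (L2 : rho <= r2) by (eapply Rle_trans; [apply Rmin_l|apply Rmin_r]).
  assert (L4 : rho <= r4) by apply Rmin_r.
  destruct (conformal_change_jet u psi f1 f2 z (f3 z) rho Hu) as (Jv & _ & _ & J11 & _ & J22).
  { intros w Hw. apply H1. lra. }
  { intros w Hw. apply H2. lra. }
  { apply H3, Hzz. }
  { intros w Hw. apply H4. lra. }
  rewrite operator_eq_quadric, !Hg by (trivial; apply is_C2_quadric).
  f_equal. unfold laplacian.
  repeat rewrite ?D1_quadric, ?D2_quadric.
  assert (E : forall s p q a b c, quadric z s p q a b c z = s).
  { intros. unfold quadric. rewrite !Rminus_diag. ring. }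
  rewrite !E, Jv, J11, J22.
  assert (HJ := sum_squares_neq_0 _ Hf1z).
  unfold dir_field', dir_deriv'.
  destruct (f1 z) as [a b]. destruct (f2 z) as [c d]. destruct (f3 z) as [e h]. simpl in *.
  (* In the sum of the two pure second derivatives the terms with psi'' and psi''' cancel,
     ln|psi'|^2 being harmonic, and so do the mixed derivatives of u. The remaining factor |psi'|^2
     cancels against exp(-ln|psi'|^2). *)
  rewrite Ropp_plus_distr, exp_plus, exp_Ropp, exp_Ropp, exp_ln by nra.
  assert (N := Rgt_not_eq _ _ (exp_pos (u (psi z)))).
  field. repeat split; nra.
Qed.

(** Invariance may be used only after excluding a pole. Differentiability makes f bounded near z,
    whereas at a pole |f| exceeds every bound on a punctured neighbourhood. *)
Lemma holomorphic_not_pole (f : C -> C) (z l : C) : is_Cderive f z l -> ~ is_pole f z.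
Proof.
  intros Hf [_ Hp]. apply is_Cderive_continuous in Hf.
  assert (H1 : @locally C_UniformSpace (f z) (fun w => Cmod (w - f z) < 1)).
  { apply (proj2 (locally_Cmod _ _)). exists (mkposreal 1 Rlt_0_1). auto. }
  apply Hf in H1.
  assert (H2 : @locally' C_UniformSpace z (fun w => Cmod (f z) + 1 < Cmod (f w))).
  { apply (Hp (fun y => Cmod (f z) + 1 < y)). now exists (Cmod (f z) + 1). }
  destruct (proj1 (locally_Cmod z _) (filter_and
    (fun w => Cmod (f w - f z) < 1) (fun w => w <> z -> Cmod (f z) + 1 < Cmod (f w)) H1 H2))
    as [delta Hdelta].
  assert (Hd := cond_pos delta).
  (* Any point of the punctured disc would do; the contradiction arises at this one. *)
  destruct (Hdelta (z + RtoC (delta / 2))%C) as [G1 G2].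
  - replace (z + RtoC (delta / 2) - z)%C with (RtoC (delta / 2)) by ring.
    rewrite Cmod_R, Rabs_pos_eq; lra.
  - assert (G3 : Cmod (f z) + 1 < Cmod (f (z + RtoC (delta / 2))%C)).
    { apply G2. intros E. apply (f_equal fst) in E. simpl in E. lra. }
    assert (G4 := Cmod_minus_ge (f (z + RtoC (delta / 2))%C) (f z)).
    assert (G5 := Cmod_triangle (f (z + RtoC (delta / 2))%C - f z) (f z)).
    replace (f (z + RtoC (delta / 2)) - f z + f z)%C with (f (z + RtoC (delta / 2))%C) in G5 by
      ring.
    lra.
Qed.

(** Horner's form reduces differentiation to one repeated step, and admitting zero leading
    coefficients keeps all derivatives in the same family. *)
Definition cubic (k0 k1 k2 k3 z : C) : C := (k0 + z * (k1 + z * (k2 + z * k3)))%C.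

Lemma is_Cderive_plus (f g : C -> C) (z lf lg : C) :
  is_Cderive f z lf -> is_Cderive g z lg ->
  is_Cderive (fun w => f w + g w)%C z (lf + lg)%C.
Proof. apply @is_derive_plus. Qed.

Lemma is_Cderive_cubic (k0 k1 k2 k3 z : C) :
  is_Cderive (cubic k0 k1 k2 k3) z (cubic k1 (2 * k2) (3 * k3) 0 z).
Proof.
  assert (Hstep : forall (k l : C) (g : C -> C), is_Cderive g z l ->
    is_Cderive (fun w => k + w * g w)%C z (g z + z * l)%C).
  { intros k l g Hg.
    replace (g z + z * l)%C with (0 + (1 * g z + z * l))%C by ring.
    apply (is_Cderive_plus (fun _ => k) (fun w => w * g w)%C); [apply is_Cderive_const|].
    apply (is_Cderive_mult (fun w => w) g); [apply is_Cderive_id | exact Hg]. }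
  assert (G := Hstep k0 _ _ (Hstep k1 _ _ (Hstep k2 _ _ (is_Cderive_const k3 z)))).
  match type of G with is_Cderive _ _ ?l =>
    replace (cubic k1 (2 * k2) (3 * k3) 0 z) with l by (unfold cubic; ring) end.
  exact G.
Qed.

Lemma invariant_form_necessary (H : R * R -> R -> R * R -> Sym2 -> R) (u : R * R ->
  R) (x : R * R) :
  conformally_invariant H -> is_C2 u ->
  operator H u x = H (0, 0) 0 (0, 0)
    (mk_sym (exp (- u x) * laplacian u x / 2) 0 (exp (- u x) * laplacian u x / 2)).
Proof.
  intros HH Hu.
  set (a := exp (- u x / 2)).
  assert (Ha : a <> 0) by (apply Rgt_not_eq, exp_pos).
  assert (Ha2 : exp (- u x) = a ^ 2).
  { unfold a. simpl. rewrite Rmult_1_r, <- exp_plus. f_equal. field. }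
  set (u1 := D1 u x). set (u2 := D2 u x).
  set (u11 := D1 (D1 u) x). set (u12 := D1 (D2 u) x). set (u22 := D2 (D2 u) x).
  (* With psi'(0) = a and psi''(0) = (p, q), the gradient of u_psi at 0 is (a u1 + 2 p / a, a u2 - 2
     q / a); p and q make it vanish. *)
  set (p := - a ^ 2 * u1 / 2). set (q := a ^ 2 * u2 / 2).
  (* With psi'''(0) = (e, h), the second derivatives satisfy D22 - D11 = c1 - 4 e / a and D12 = c2 -
     2 h / a, where c1 and c2 are the parenthesised factors here and in [h]; e and h make both
     vanish. *)
  set (e := a / 4 * (- 2 * p * u1 - 2 * q * u2 + a ^ 2 * (u22 - u11) + 4 * (p ^ 2 - q ^ 2)
    / a ^ 2)).
  set (h := a / 2 * (- q * u1 + p * u2 + a ^ 2 * u12 + 4 * p * q / a ^ 2)).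
  set (psi := cubic x (RtoC a) (p / 2, q / 2) (e / 6, h / 6)).
  set (f1 := cubic (RtoC a) (2 * (p / 2, q / 2)%R)%C (3 * (e / 6, h / 6)%R)%C 0).
  set (f2 := cubic (2 * (p / 2, q / 2)%R)%C (2 * (3 * (e / 6, h / 6)%R))%C (3 * 0)%C 0).
  set (f3 := cubic (2 * (3 * (e / 6, h / 6)%R))%C (2 * (3 * 0))%C (3 * 0)%C 0).
  assert (H1 : forall z, is_Cderive psi z (f1 z)) by (intros z; apply is_Cderive_cubic).
  assert (H2 : forall z, is_Cderive f1 z (f2 z)) by (intros z; apply is_Cderive_cubic).
  assert (H3 : forall z, is_Cderive f2 z (f3 z)) by (intros z; apply is_Cderive_cubic).
  assert (Epsi : psi 0 = x) by (apply C_eq; unfold psi, cubic; simpl; ring).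
  assert (Ef1 : f1 0 = RtoC a) by (apply C_eq; unfold f1, cubic; simpl; ring).
  assert (Ef2 : f2 0 = (p, q)) by (apply C_eq; unfold f2, cubic; simpl; field).
  assert (Ef3 : f3 0 = (e, h)) by (apply C_eq; unfold f3, cubic; simpl; field).
  destruct (neq_0_nearby f1 0 (f2 0) (H2 0)) as [rho Hrho].
  { rewrite Ef1. intros E. apply Ha. now apply RtoC_inj. }
  destruct (conformal_change_jet u psi f1 f2 0 (f3 0) rho Hu) as (Jv & J1 & J2 & J11 & J12 &
    J22); auto.
  (* Invariance is read from right to left: the jet of u at x = psi(0) is exchanged for that of
     u_psi at 0. *)
  rewrite <- Epsi at 1.
  rewrite <- (HH psi u).
  - unfold operator, grad, hessian. rewrite Jv, J1, J2, J11, J12, J22.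
    unfold dir_field, dir_field', dir_deriv, dir_deriv'.
    rewrite Ef1, Ef2, Ef3, Epsi, Ha2. unfold laplacian.
    fold u1 u2 u11 u12 u22. simpl.
    f_equal.
    + replace (a * (a * 1) + 0 * (0 * 1)) with (a ^ 2) by ring.
      rewrite <- Ha2, ln_exp. ring.
    + f_equal; unfold p, q; field; exact Ha.
    (* The diagonal entries are equal, so each is half of their sum a^2 (u11 + u22). *)
    + f_equal; unfold e, h, p, q; field; exact Ha.
  - intros z. left. apply (proj2 (locally_Cmod z _)).
    exists (mkposreal 1 Rlt_0_1). intros w _. eexists. apply H1.
  - exact Hu.
  - apply (holomorphic_not_pole _ _ _ (H1 0)).
  - intros E. apply (is_Cderive_unique psi 0 _ _ (H1 0)) in E. rewrite Ef1 in E.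
    apply Ha. now apply RtoC_inj.
Qed.

Theorem proposition1p2 :
  forall H : R * R -> R -> R * R -> Sym2 -> R,
    conformally_invariant H <->
    exists g : R -> R,
      forall u : R * R -> R, is_C2 u ->
        forall x : R * R,
          operator H u x = g (- exp (- u x) * laplacian u x).
Proof.
  intros H. split.
  - intros HH.
    (* The argument t stands for minus e^{-u} times the Laplacian, hence the sign in the diagonal
       entries. *)
    exists (fun t => H (0, 0) 0 (0, 0) (mk_sym (- t / 2) 0 (- t / 2))).
    intros u Hu x. rewrite (invariant_form_necessary H u x HH Hu).
    replace (- (- exp (- u x) * laplacian u x) / 2) with (exp (- u x) * laplacian u x / 2) by
      field.
    reflexivity.
  - intros [g Hg]. exact (invariant_form_sufficient H g Hg).
Qed.
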